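(* For every $p\in(1,2]$ there exist a constant $c_p\in(0,2)$ and a sequence $\eta_n\to0$ (both depending only on $p$) such that the following holds. For every $n\in\mathbb{N}$, every $\mathbf{k}=(k_1,\dots,k_{m+1})$ with integers $0=k_1<k_2<\cdots<k_{m+1}=n$, every bounded measurable $S\subseteq\mathbb{R}^n$ of positive volume, and every $\lambda\ge n^{-1}c_p^{-n}$, $$\alpha_{S}(\lambda)\ \ge\ (1+\eta_n)\,\frac{\log(2/c_p)\cdot n}{2^n}.$$
   Context: $\log$ is the natural logarithm. For $\mathbf{x}\in\mathbb{R}^n$ put $\mathbf{x}_j=(x_{k_j+1},\dots,x_{k_{j+1}})$, $\|\mathbf{x}\|_{p,\mathbf{k},n}=(\sum_{j=1}^m\|\mathbf{x}_j\|_2^p)^{1/p}$ ($\|\cdot\|_2$ Euclidean norm), $d(\mathbf{x},\mathbf{y})=\|\mathbf{y}-\mathbf{x}\|_{p,\mathbf{k},n}$, $B^n_{p,\mathbf{k}}(\mathbf{x},r)=\{\mathbf{y}:d(\mathbf{x},\mathbf{y})\le r\}$, and let $r_n=r_{p,\mathbf{k},n}$ be the radius with $\mathrm{vol}(B^n_{p,\mathbf{k}}(\mathbf 0,r_n))=1$. Hard superball model: for bounded measurable $S\subseteq\mathbb{R}^n$ and integer $t\ge1$ let $\hat Z_S(t)=\frac1{t!}\int_{S^t}\mathbf 1[d(\mathbf{x}_i,\mathbf{x}_j)\ge2r_n\ \forall i\ne j]\,d\mathbf{x}_1\cdots d\mathbf{x}_t$, $\hat Z_S(0)=1$, and $Z_S(\lambda)=\sum_{t\ge0}\lambda^t\hat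 Z_S(t)$. The (grand canonical) hard superball model on $S$ at fugacity $\lambda>0$ is the random finite set $X\subseteq S$ obtained by choosing $|X|=t$ with probability $\lambda^t\hat Z_S(t)/Z_S(\lambda)$ and then choosing $X$ uniformly (with respect to Lebesgue measure) among unordered $t$-subsets of $S$ with pairwise distances $d\ge2r_n$. For $S$ of positive volume, $\alpha_S(\lambda)=\mathbb{E}|X|/\mathrm{vol}(S)$ is the expected packing density. *)

(* Defs.v *)
From HB Require Import structures.
From mathcomp Require Import all_boot all_order all_algebra.
From mathcomp Require Import all_classical all_reals all_analysis.
Set Implicit Arguments. Unset Strict Implicit. Unset Printing Implicit Defensive.
Import Order.TTheory GRing.Theory Num.Theory.
Import numFieldNormedType.Exports.
Local Open Scope classical_set_scope.
Local Open Scope ring_scope.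

Section HardSuperball.
Context {R : realType}.

(* Points of R^n are n-tuples of reals.  The n-dimensional Lebesgue integral of a
   nonnegative function is defined as the iterated one-dimensional Lebesgue
   integral (the n-fold product of the Lebesgue measure, built by sections,
   exactly as product_measure1). *)
Fixpoint iint (m : nat) : (m.-tuple R -> \bar R) -> \bar R :=
  match m return (m.-tuple R -> \bar R) -> \bar R with
  | 0 => fun F => F [tuple]
  | m'.+1 => fun F =>
      (\int[@lebesgue_measure R]_x iint (fun t : m'.-tuple R => F (cons_tuple x t)))%E
  end.

Definition vol (n : nat) (S : set (n.-tuple R)) : \bar R :=
  iint (fun x => (\1_S x)%:E).

(* Lebesgue measurability: S differs from a Borel set by a null set
   (i.e. S belongs to the completion of the Borel sigma-algebra). *)
Definition leb_measurable (n : nat) (S : set (n.-tuple R)) : Prop :=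
  exists A B : set (n.-tuple R),
    [/\ measurable A, measurable B, A `<=` S, S `<=` B & vol (B `\` A) = 0%E].

Definition bounded_tset (n : nat) (S : set (n.-tuple R)) : Prop :=
  exists M : R, forall x, S x -> forall i : 'I_n, `|tnth x i| <= M.

Definition valid_k (n : nat) (ks : seq nat) : Prop :=
  [/\ (1 < size ks)%N, nth 0%N ks 0 = 0%N, last 0%N ks = n & sorted ltn ks].

(* d(x,y) = || y - x ||_{p,k,n}
   = ( sum_{j=1}^m || (y-x)_j ||_2^p )^{1/p},
   block j (0-indexed here) = coordinates k_j <= i < k_{j+1} (0-indexed). *)
Definition pkdist (p : R) (ks : seq nat) (n : nat) (x y : n.-tuple R) : R :=
  (\sum_(j < (size ks).-1)
      (Num.sqrt (\sum_(nth 0%N ks j <= i < nth 0%N ks j.+1)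
                   (nth 0 y i - nth 0 x i) ^+ 2)) `^ p) `^ p^-1.

Definition pkball (p : R) (ks : seq nat) (n : nat) (x : n.-tuple R) (r : R)
  : set (n.-tuple R) := [set y | pkdist p ks x y <= r].

Definition origin (n : nat) : n.-tuple R := nseq_tuple n (0 : R).

(* r_n : the radius with vol(B(0, r_n)) = 1 (volume is continuous and strictly
   increasing in r > 0, so this supremum is that radius). *)
Definition rn (p : R) (ks : seq nat) (n : nat) : R :=
  sup [set r : R | (vol (pkball p ks (origin n) r) <= 1)%E].

Fixpoint cint (n t : nat) (G : seq (n.-tuple R) -> \bar R) : \bar R :=
  match t with
  | 0 => G [::]
  | t'.+1 => iint (fun x => cint t' (fun xs => G (x :: xs)))
  end.

Definition config_ok (p : R) (ks : seq nat) (n : nat) (S : set (n.-tuple R))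
  (xs : seq (n.-tuple R)) : Prop :=
  (forall i, (i < size xs)%N -> S (nth (nseq_tuple n (0 : R)) xs i)) /\
  (forall i j, (i < size xs)%N -> (j < size xs)%N -> i <> j ->
     2 * rn p ks n <= pkdist p ks (nth (nseq_tuple n (0 : R)) xs i)
                                 (nth (nseq_tuple n (0 : R)) xs j)).

Definition Zhat (p : R) (ks : seq nat) (n : nat) (S : set (n.-tuple R)) (t : nat)
  : \bar R :=
  ((t`!%:R)^-1)%:E * cint t (fun xs => (\1_(config_ok p ks S) xs)%:E).

Definition Zpart (p : R) (ks : seq nat) (n : nat) (S : set (n.-tuple R)) (lam : R)
  : \bar R := (\sum_(0 <= t <oo) (lam ^+ t)%:E * Zhat p ks S t)%E.

(* sum_t t lambda^t \hat Z_S(t) = Z_S(lambda) * E|X| *)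
Definition Zmom (p : R) (ks : seq nat) (n : nat) (S : set (n.-tuple R)) (lam : R)
  : \bar R := (\sum_(0 <= t <oo) (t%:R * lam ^+ t)%:E * Zhat p ks S t)%E.

Definition expected_size (p : R) (ks : seq nat) (n : nat) (S : set (n.-tuple R))
  (lam : R) : R := fine (Zmom p ks S lam) / fine (Zpart p ks S lam).

Definition alpha (p : R) (ks : seq nat) (n : nat) (S : set (n.-tuple R)) (lam : R)
  : R := expected_size p ks S lam / fine (vol S).

End HardSuperball.

(* Main.v *)
(* Jenssen-Joos-Perkins local argument, for the norm of l_p(l_2).  Write
   Z_A for the partition function on A, A_u for the points of A at distance at
   least 2 r_n from u, and M_A = lam int_A Z_(A_u) du, so that M_A / Z_A is the
   expected number of points.  Fix x and let T be the random set of points of S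
   within distance 2 r_n of x that are not blocked by the points of the configuration
   farther away.  Summing over that outer configuration turns Z_S, Z_(S_x) and
   lam int_(S near x) Z_(S_u) du into the averages of Z_T, 1 and M_T.
   Uniform convexity of the norm makes
     int_T |T \ T_u| du <= 2 c^n |T|   with c < 2 depending only on p,
   because of two points of T within distance 2 r_n, the one nearer to x lies in
   a ball of radius c r_n.  Hence M_T >= (1 - 2 lam c^n) lam |T| Z_T, and since
   Z_T <= exp(lam |T|),
     M_T >= (1 - 2 lam c^n) Z_T ln Z_T
         >= (1 - 2 lam c^n) ((1 + ln W) Z_T - W)   for every W > 0.
   Averaging over the outer configuration and then over x in S gives
     2^n alpha + (1 - 2 lam c^n) (W / lam) alpha >= (1 - 2 lam c^n) (1 + ln W),
   which at lam = 1 / (n c^n), with W of order 2^n lam / (n ln (2 / c)), is the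
   claim; larger lam follow because alpha increases with lam. *)
Require Import Defs.
From HB Require Import structures.
From mathcomp Require Import all_boot all_order all_algebra.
From mathcomp Require Import all_classical all_reals all_analysis.
From mathcomp Require Import measurable_realfun ring lra.
Set Implicit Arguments. Unset Strict Implicit. Unset Printing Implicit Defensive.
Import Order.TTheory GRing.Theory Num.Theory.
Import numFieldNormedType.Exports.
Local Open Scope classical_set_scope.
Local Open Scope ring_scope.

(** The averaging over outer configurations is kept unnormalised and algebraic. Sets become
    nonnegative weights: conditioning on a point multiplies a weight by a pair factor, and
    separating near from far points writes a weight as a sum. Conditioning is then a binomial
    expansion of configuration integrals followed by Tonelli. The resulting average is linear and
    monotone, which is why the entropy enters through its tangent: a bound affine in [Z_T] passes
    through the average, and [W] is chosen at the very end. Values are extended reals, so losses are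
    moved to the other side instead of being subtracted. Volumes and configuration integrals are
    iterated integrals, and [S] is only enclosed between Borel sets, so its sections may fail to be
    Borel. Monotonicity of the integral is therefore proved for arbitrary nonnegative functions, [S]
    is squeezed between Borel sets, and on Borel functions a sigma-finite measure represents the
    iterated integral. In the convexity estimate a block where two vectors almost agree gains
    nothing. The inequality for one block carries an error term, paid for by the separation of the
    whole vectors. *)

Lemma ln_le_subr1 (R : realType) (x : R) : 0 < x -> ln x <= x - 1.
Proof.
move=> x0; have : ln (1 + (x - 1)) <= x - 1 by rewrite le_ln1Dx// ltrBrDl subrr.
by rewrite addrC subrK.
Qed.

(** * Weighted configuration integrals *)

Section GasFunctionals.
Context d (T : measurableType d) (R : realType)
  (mu : {sigma_finite_measure set T -> \bar R}) (h : T -> T -> \bar R).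
Local Open Scope ereal_scope.

(* Measurability of a functional of weights is tested on families indexed by an
   arbitrary measurable space: integrating out a point then only enlarges W. *)
Definition mfunctional (Phi : (T -> \bar R) -> \bar R) : Prop :=
  (forall f, (forall x, 0 <= f x) -> 0 <= Phi f) /\
  (forall d' (W : measurableType d') (F : W * T -> \bar R),
     measurable_fun setT F -> (forall w, 0 <= F w) ->
     measurable_fun setT (fun w => Phi (fun y => F (w, y)))).

(** The weight form of [A_u]: for the indicator of a set and the hard-core factor, the points of the
    set compatible with [x]. *)
Definition link (f : T -> \bar R) (x : T) : T -> \bar R := fun y => f y * h x y.

(* k mutually compatible points are drawn with weight g, and Phi is evaluated at
   the part of b compatible with all of them. *)
Fixpoint ys (Phi : (T -> \bar R) -> \bar R) (k : nat) (g b : T -> \bar R) : \bar R :=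
  if k is k'.+1 then \int[mu]_x (g x * ys Phi k' (link g x) (link b x))
  else Phi b.

(* For f the indicator of S, hs t f / t! is the paper's hat Z_S(t). *)
Fixpoint hs (t : nat) (f : T -> \bar R) : \bar R :=
  if t is t'.+1 then \int[mu]_x (f x * hs t' (link f x)) else 1.

Hypothesis mh : measurable_fun setT (fun z : T * T => h z.1 z.2).
Hypothesis h0 : forall x y, 0 <= h x y.
Hypothesis hsym : forall x y, h x y = h y x.

Lemma link_ge0 f x : (forall y, 0 <= f y) -> forall y, 0 <= link f x y.
Proof. by move=> f0 y; rewrite mule_ge0. Qed.

Lemma linkC f x y : link (link f x) y = link (link f y) x.
Proof. by apply/funext => z; rewrite /link muleAC. Qed.

Lemma measurable_linkW {d'} {W : measurableType d'} (F : W * T -> \bar R) :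
  measurable_fun setT F ->
  measurable_fun setT (fun z : (W * T) * T => link (fun y => F (z.1.1, y)) z.1.2 z.2).
Proof.
move=> mF.
have m12 : measurable_fun setT (fun z : (W * T) * T => z.1.2).
  exact: (measurableT_comp measurable_snd measurable_fst).
have m11 : measurable_fun setT (fun z : (W * T) * T => z.1.1).
  exact: (measurableT_comp measurable_fst measurable_fst).
apply: (emeasurable_funM
    (f := fun z : (W * T) * T => F (z.1.1, z.2))
    (g := fun z : (W * T) * T => h z.1.2 z.2)).
  apply: (measurableT_comp mF (g := fun z : (W * T) * T => (z.1.1, z.2))).
  exact: measurable_fun_pair.
apply: (measurableT_comp mh (g := fun z : (W * T) * T => (z.1.2, z.2))).
exact: measurable_fun_pair.
Qed.

Lemma ys_ge0 Phi k g b : mfunctional Phi -> (forall x, 0 <= g x) ->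
  (forall x, 0 <= b x) -> 0 <= ys Phi k g b.
Proof.
move=> [P0 _]; elim: k g b => [|k IH] g b g0 b0 /=; first exact: P0.
by apply: integral_ge0 => x _; rewrite mule_ge0// IH//; exact: link_ge0.
Qed.

Lemma measurable_ys Phi k : mfunctional Phi ->
  forall d' (W : measurableType d') (G B : W * T -> \bar R),
  measurable_fun setT G -> (forall w, 0 <= G w) ->
  measurable_fun setT B -> (forall w, 0 <= B w) ->
  measurable_fun setT (fun w => ys Phi k (fun y => G (w, y)) (fun y => B (w, y))).
Proof.
move=> mP; elim: k => [|k IH] d' W G B mG G0 mB B0 /=; first exact: mP.2.
pose F (z : W * T) := G z *
  ys Phi k (link (fun y => G (z.1, y)) z.2) (link (fun y => B (z.1, y)) z.2).
apply: (measurable_fun_fubini_tonelli_F (m2 := mu) F) => [|z].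
  apply: emeasurable_funM => //.
  apply: (IH _ (W * T)%type
    (fun z : (W * T) * T => link (fun y => G (z.1.1, y)) z.1.2 z.2)
    (fun z : (W * T) * T => link (fun y => B (z.1.1, y)) z.1.2 z.2)) => [|w||w].
  - exact: measurable_linkW.
  - exact: link_ge0.
  - exact: measurable_linkW.
  - exact: link_ge0.
rewrite mule_ge0//; apply: ys_ge0 => //; exact: link_ge0.
Qed.

Lemma ys1 k g b : ys (fun=> 1) k g b = hs k g.
Proof. by elim: k g b => [|k IH] g b //=; apply: eq_integral => x _; rewrite IH. Qed.

Lemma mfunctional_cst c : 0 <= c -> mfunctional (fun=> c).
Proof. by move=> c0; split. Qed.

Lemma mfunctional_hs t : mfunctional (hs t).
Proof.
split=> [f f0|d' W F mF F0].
  by rewrite -(ys1 t f f); apply: ys_ge0 => //; exact: mfunctional_cst.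
have := measurable_ys t (mfunctional_cst lee01) mF F0 mF F0.
by congr (measurable_fun _ _); apply/funext => w; rewrite ys1.
Qed.

(** Draws one point and evaluates [Phi] on what it leaves. For [Phi := Zp lam], multiplied by [lam],
    this is the overview's [M_A]. It is convertible to [ys Phi 1 f f]. *)
Definition pick (Phi : (T -> \bar R) -> \bar R) (f : T -> \bar R) : \bar R :=
  \int[mu]_x (f x * Phi (link f x)).

Lemma mfunctional_pick Phi : mfunctional Phi -> mfunctional (pick Phi).
Proof.
move=> mP; split=> [f f0|d' W F mF F0].
  by apply: (@ys_ge0 _ 1 f f).
exact: (measurable_ys 1 mP mF F0 mF F0).
Qed.

Lemma measurable_link (g : T -> \bar R) : measurable_fun setT g ->
  measurable_fun setT (fun z : T * T => link g z.1 z.2).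
Proof.
move=> mg; apply: (emeasurable_funM (f := fun z : T * T => g z.2)) => //.
exact: measurableT_comp.
Qed.

Lemma measurable_link1 (g : T -> \bar R) x : measurable_fun setT g ->
  measurable_fun setT (link g x).
Proof. by move=> mg; exact: (measurable_fun_pair2 x (measurable_link mg)). Qed.

Lemma measurable_ys_link Phi k (g b : T -> \bar R) : mfunctional Phi ->
  measurable_fun setT g -> (forall x, 0 <= g x) ->
  measurable_fun setT b -> (forall x, 0 <= b x) ->
  measurable_fun setT (fun x => ys Phi k (link g x) (link b x)).
Proof.
move=> mP mg g0 mb b0.
apply: (@measurable_ys Phi k mP _ T (fun z => link g z.1 z.2)
  (fun z => link b z.1 z.2)) => [|w||w].
- exact: measurable_link.
- exact: link_ge0.
- exact: measurable_link.
- exact: link_ge0.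
Qed.

Lemma measurable_ys_link2 Phi k (g b : T -> \bar R) : mfunctional Phi ->
  measurable_fun setT g -> (forall x, 0 <= g x) ->
  measurable_fun setT b -> (forall x, 0 <= b x) ->
  measurable_fun setT (fun z : T * T =>
    ys Phi k (link (link g z.1) z.2) (link (link b z.1) z.2)).
Proof.
move=> mP mg g0 mb b0.
apply: (@measurable_ys Phi k mP _ (T * T)%type
  (fun z : (T * T) * T => link (link g z.1.1) z.1.2 z.2)
  (fun z : (T * T) * T => link (link b z.1.1) z.1.2 z.2)) => [|w||w].
- exact: (measurable_linkW (F := fun z => link g z.1 z.2) (measurable_link mg)).
- by do 2 apply: link_ge0.
- exact: (measurable_linkW (F := fun z => link b z.1 z.2) (measurable_link mb)).
- by do 2 apply: link_ge0.
Qed.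

(** A point of [b] drawn before the [k] points of [g] can equally be drawn after them: Tonelli and
    the symmetry of [h] move it past one point of [g] at a time. *)
Lemma ys_pick Phi k (g b : T -> \bar R) : mfunctional Phi ->
  measurable_fun setT g -> (forall x, 0 <= g x) ->
  measurable_fun setT b -> (forall x, 0 <= b x) ->
  \int[mu]_x (b x * ys Phi k (link g x) (link b x)) = ys (pick Phi) k g b.
Proof.
move=> mP; elim: k g b => [//|k IH] g b mg g0 mb b0 /=.
pose F (z : T * T) := b z.1 * g z.2 * h z.1 z.2 *
  ys Phi k (link (link g z.1) z.2) (link (link b z.1) z.2).
have F0 z : 0 <= F z.
  rewrite !mule_ge0//; apply: ys_ge0 => // x; by do 2 apply: link_ge0.
have mF : measurable_fun setT F.
  apply: emeasurable_funM; last exact: measurable_ys_link2.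
  apply: emeasurable_funM => //.
  apply: emeasurable_funM; exact: measurableT_comp.
transitivity (\int[mu]_x \int[mu]_u F (x, u)).
  apply: eq_integral => x _; rewrite -ge0_integralZl//.
  - by apply: eq_integral => u _; rewrite /F /= {1}/link !muleA.
  - apply: emeasurable_funM; first exact: measurable_link1.
    apply: measurable_ys_link => //; try exact: measurable_link1.
    + exact: link_ge0.
    + exact: link_ge0.
  - move=> u _; rewrite mule_ge0//; first exact: link_ge0.
    apply: ys_ge0 => // y; by do 2 apply: link_ge0.
rewrite fubini_tonelli//; apply: eq_integral => u _.
rewrite -(IH _ _ (measurable_link1 u mg) (link_ge0 u g0)
  (measurable_link1 u mb) (link_ge0 u b0)) -ge0_integralZl//.
- apply: eq_integral => x _; rewrite /F /= linkC (linkC b) !muleA.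
  by congr (_ * _); rewrite (hsym x) [b x * g u]muleC.
- apply: emeasurable_funM; first exact: measurable_link1.
  apply: measurable_ys_link => //; try exact: measurable_link1.
  + exact: link_ge0.
  + exact: link_ge0.
- move=> x _; rewrite mule_ge0//; first exact: link_ge0.
  apply: ys_ge0 => // y; by do 2 apply: link_ge0.
Qed.

Lemma linkD (g b : T -> \bar R) x : (forall x, 0 <= g x) -> (forall x, 0 <= b x) ->
  link (fun y => g y + b y) x = (fun y => link g x y + link b x y).
Proof. by move=> g0 b0; apply/funext => y; rewrite /link ge0_muleDl. Qed.

Lemma pascal_sum t (a : nat -> nat -> \bar R) : (forall k l, 0 <= a k l) ->
  \sum_(k < t.+1) ('C(t, k)%:R)%:E * a k.+1 (t - k)%N +
  \sum_(k < t.+1) ('C(t, k)%:R)%:E * a k (t - k).+1 =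
  \sum_(k < t.+2) ('C(t.+1, k)%:R)%:E * a k (t.+1 - k)%N.
Proof.
move=> a0; rewrite [RHS]big_ord_recl bin0 subn0.
under [X in _ = _ + X]eq_bigr => i _.
  rewrite /= /bump leq0n add1n binS natrD EFinD ge0_muleDl ?lee_fin// subSS; over.
rewrite big_split/= addeC [in LHS]big_ord_recl bin0 subn0 -addeA; congr (_ + _).
congr (_ + _); rewrite [in RHS]big_ord_recr/= bin_small// mul0e adde0.
by apply: eq_bigr => i _; rewrite /= /bump leq0n add1n subnSK.
Qed.

Lemma hsS t f : hs t.+1 f = pick (hs t) f.
Proof. by []. Qed.

(** Each of the [t] points belongs to [g] or to [b]; [k] of them belong to [g], and the others see
    [b] thinned by these. In the induction the first point comes from [g], which is one more step of
    [ys], or from [b], and then [ys_pick] moves it behind the points of [g]. Pascal's rule adds the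
    two cases. *)
Lemma hsD t (g b : T -> \bar R) :
  measurable_fun setT g -> (forall x, 0 <= g x) ->
  measurable_fun setT b -> (forall x, 0 <= b x) ->
  hs t (fun x => g x + b x) =
  \sum_(k < t.+1) ('C(t, k)%:R)%:E * ys (hs (t - k)) k g b.
Proof.
elim: t g b => [|t IH] g b mg g0 mb b0.
  by rewrite big_ord1 bin0 mul1e.
rewrite -(pascal_sum t (a := fun k l => ys (hs l) k g b)); last first.
  by move=> k l; apply: ys_ge0 => //; exact: mfunctional_hs.
pose S x := \sum_(k < t.+1) ('C(t, k)%:R)%:E * ys (hs (t - k)) k (link g x) (link b x).
have S0 x : 0 <= S x.
  apply: sume_ge0 => k _; rewrite mule_ge0 ?lee_fin//; apply: ys_ge0.
  - exact: mfunctional_hs.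
  - exact: link_ge0.
  - exact: link_ge0.
have mY k l : measurable_fun setT (fun x => ys (hs l) k (link g x) (link b x)).
  by apply: measurable_ys_link => //; exact: mfunctional_hs.
have mS : measurable_fun setT S.
  by apply: emeasurable_sum => k; exact: emeasurable_funM.
have SE (w : T -> \bar R) : measurable_fun setT w -> (forall x, 0 <= w x) ->
    \int[mu]_x (w x * S x) = \sum_(k < t.+1) ('C(t, k)%:R)%:E *
      \int[mu]_x (w x * ys (hs (t - k)) k (link g x) (link b x)).
  move=> mw w0.
  have Y0 k l x : 0 <= ys (hs l) k (link g x) (link b x).
    by apply: ys_ge0; [exact: mfunctional_hs|exact: link_ge0|exact: link_ge0].
  under eq_integral => x _.
    rewrite ge0_sume_distrr; last by move=> i _; rewrite mule_ge0 ?lee_fin.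
    over.
  rewrite ge0_integral_sum//=.
  - apply: eq_bigr => k _; rewrite -ge0_integralZl//.
    + by apply: eq_integral => x _; rewrite muleCA.
    + exact: emeasurable_funM.
    + by move=> x _; rewrite mule_ge0.
  - by move=> k; do 2 apply: emeasurable_funM => //.
  - by move=> k x _; rewrite !mule_ge0 ?lee_fin.
rewrite hsS /pick.
transitivity (\int[mu]_x (g x * S x) + \int[mu]_x (b x * S x)).
  rewrite -ge0_integralD//.
  - apply: eq_integral => x _; rewrite -ge0_muleDl// linkD// IH//.
    + exact: measurable_link1.
    + exact: link_ge0.
    + exact: measurable_link1.
    + exact: link_ge0.
  - by move=> x _; rewrite mule_ge0.
  - exact: emeasurable_funM.
  - by move=> x _; rewrite mule_ge0.
  - exact: emeasurable_funM.
rewrite !SE//; congr (_ + _); apply: eq_bigr => k _; congr (_ * _).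
exact: (ys_pick k (mfunctional_hs (t - k)) mg g0 mb b0).
Qed.

Lemma ysZ (c : R) Phi k g b : (0 <= c)%R -> mfunctional Phi ->
  measurable_fun setT g -> (forall x, 0 <= g x) ->
  measurable_fun setT b -> (forall x, 0 <= b x) ->
  ys (fun f => c%:E * Phi f) k g b = c%:E * ys Phi k g b.
Proof.
move=> c0 mP; elim: k g b => [//|k IH] g b mg g0 mb b0 /=.
rewrite -ge0_integralZl//.
- apply: eq_integral => x _; rewrite IH.
  + by rewrite muleCA.
  + exact: measurable_link1.
  + exact: link_ge0.
  + exact: measurable_link1.
  + exact: link_ge0.
- by apply: emeasurable_funM => //; exact: measurable_ys_link.
- move=> x _; rewrite mule_ge0// ys_ge0//; exact: link_ge0.
Qed.

Lemma ysD Phi Psi k g b : mfunctional Phi -> mfunctional Psi ->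
  measurable_fun setT g -> (forall x, 0 <= g x) ->
  measurable_fun setT b -> (forall x, 0 <= b x) ->
  ys (fun f => Phi f + Psi f) k g b = ys Phi k g b + ys Psi k g b.
Proof.
move=> mP mQ; elim: k g b => [//|k IH] g b mg g0 mb b0 /=.
rewrite -ge0_integralD//.
- apply: eq_integral => x _; rewrite IH.
  + rewrite ge0_muleDr// ys_ge0//; exact: link_ge0.
  + exact: measurable_link1.
  + exact: link_ge0.
  + exact: measurable_link1.
  + exact: link_ge0.
- move=> x _; rewrite mule_ge0// ys_ge0//; exact: link_ge0.
- by apply: emeasurable_funM => //; exact: measurable_ys_link.
- move=> x _; rewrite mule_ge0// ys_ge0//; exact: link_ge0.
- by apply: emeasurable_funM => //; exact: measurable_ys_link.
Qed.

(** The factor is a value of a weight and may be infinite; then either all terms vanish or a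
    positive one makes both sides infinite. *)
Lemma ge0_nneseriesZl (f : nat -> \bar R) (y : \bar R) : (forall i, 0 <= f i) ->
  0 <= y -> y * (\sum_(0 <= l <oo) f l) = \sum_(0 <= l <oo) y * f l.
Proof.
move=> f0; case: y => [r r0|_|//]; first by rewrite nneseriesZl.
have [/existsNP[l /eqP fl]|fE] := pselect (~ forall l, f l = 0); last first.
  have {}fE := contrapT fE; rewrite eseries0 ?mule0; last by move=> *; exact: fE.
  by rewrite eseries0// => l _ _; rewrite fE mule0.
have {}fl : 0 < f l by rewrite lt0e fl f0.
have s0 : 0 < \sum_(0 <= l <oo) f l.
  apply: (lt_le_trans fl); apply: le_trans (nneseries_lim_ge l.+1 _) => //.
  by rewrite big_nat_recr//= leeDr// sume_ge0.
rewrite gt0_mulye//; apply/esym; apply: (nneseries_pinfty (k := l)) => //.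
  by move=> i _; rewrite mule_ge0.
by rewrite gt0_mulye.
Qed.

Lemma ys_nneseries (Phi : nat -> (T -> \bar R) -> \bar R) k g b :
  (forall l, mfunctional (Phi l)) ->
  measurable_fun setT g -> (forall x, 0 <= g x) ->
  measurable_fun setT b -> (forall x, 0 <= b x) ->
  ys (fun f => \sum_(0 <= l <oo) Phi l f) k g b =
  \sum_(0 <= l <oo) ys (Phi l) k g b.
Proof.
move=> mP; elim: k g b => [//|k IH] g b mg g0 mb b0 /=.
have Y0 l x : 0 <= ys (Phi l) k (link g x) (link b x).
  rewrite ys_ge0//; exact: link_ge0.
rewrite -integral_nneseries//.
- apply: eq_integral => x _; rewrite IH ?ge0_nneseriesZl//.
  + exact: measurable_link1.
  + exact: link_ge0.
  + exact: measurable_link1.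
  + exact: link_ge0.
- by move=> l; apply: emeasurable_funM => //; exact: measurable_ys_link.
- by move=> l x _; rewrite mule_ge0.
Qed.

Lemma mfunctional_nneseries (Phi : nat -> (T -> \bar R) -> \bar R) :
  (forall l, mfunctional (Phi l)) ->
  mfunctional (fun f => \sum_(0 <= l <oo) Phi l f).
Proof.
move=> mP; split=> [f f0|d' W F mF F0].
  by apply: nneseries_ge0 => l _ _; exact: (mP l).1.
apply: (ge0_emeasurable_sum (h := fun l w => Phi l (fun y => F (w, y)))
  (P := xpredT)) => [l w _ _|l _]; last exact: (mP l).2.
by apply: (mP l).1 => y.
Qed.

Lemma mfunctionalZ (c : R) Phi : (0 <= c)%R -> mfunctional Phi ->
  mfunctional (fun f => c%:E * Phi f).
Proof.
move=> c0 mP; split=> [f f0|d' W F mF F0]; first by rewrite mule_ge0// mP.1.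
by apply: emeasurable_funM => //; exact: mP.2.
Qed.

Lemma mfunctionalD Phi Psi : mfunctional Phi -> mfunctional Psi ->
  mfunctional (fun f => Phi f + Psi f).
Proof.
move=> mP mQ; split=> [f f0|d' W F mF F0]; first by rewrite adde_ge0 ?mP.1 ?mQ.1.
by apply: emeasurable_funD; [exact: mP.2|exact: mQ.2].
Qed.

(** * Partition functions and the average over outer configurations *)

Definition zc t f : \bar R := ((t`!%:R)^-1)%:E * hs t f.

Definition Zp (lam : R) f : \bar R := \sum_(0 <= t <oo) (lam ^+ t)%:E * zc t f.

Definition mom (lam : R) f : \bar R :=
  \sum_(0 <= t <oo) (t%:R * lam ^+ t)%:E * zc t f.

(** The unnormalised average over an outer configuration of weight [g], at fugacity [lam], of [Phi]
    at the part of [b] that the configuration leaves unblocked. *)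
Definition Yp (lam : R) Phi g b : \bar R :=
  \sum_(0 <= k <oo) (lam ^+ k)%:E * (((k`!%:R)^-1)%:E * ys Phi k g b).

Lemma zc_ge0 t f : (forall x, 0 <= f x) -> 0 <= zc t f.
Proof. by move=> f0; rewrite mule_ge0 ?lee_fin ?invr_ge0//; exact: (mfunctional_hs t).1. Qed.

Lemma mfunctional_zc t : mfunctional (zc t).
Proof. by apply: mfunctionalZ => //; exact: mfunctional_hs. Qed.

Lemma mfunctional_Zp lam : (0 <= lam)%R -> mfunctional (Zp lam).
Proof.
move=> l0; apply: mfunctional_nneseries => t.
by apply: mfunctionalZ; rewrite ?exprn_ge0//; exact: mfunctional_zc.
Qed.

Lemma Zp_ge1 lam f : (0 <= lam)%R -> (forall x, 0 <= f x) -> 1 <= Zp lam f.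
Proof.
move=> l0 f0; apply: le_trans (nneseries_lim_ge 1%N _) => [|k _].
  by rewrite big_nat1/= /zc fact0 invr1 !mul1e.
by rewrite mule_ge0 ?lee_fin ?exprn_ge0// zc_ge0.
Qed.

Lemma nneseries_triangle (a : nat -> nat -> \bar R) : (forall k l, 0 <= a k l) ->
  \sum_(0 <= t <oo) \sum_(k < t.+1) a k (t - k)%N =
  \sum_(0 <= k <oo) \sum_(0 <= l <oo) a k l.
Proof.
move=> a0.
transitivity (\sum_(0 <= t <oo) \sum_(0 <= k <oo)
    (if (k <= t)%N then a k (t - k)%N else 0)).
  apply: eq_eseriesr => t _; rewrite (nneseries_split _ t.+1); last first.
    by move=> k _; case: ifP.
  rewrite add0n big_mkord [X in _ = _ + X]eseries0 ?adde0.
    by apply: eq_bigr => k _; rewrite -ltnS ltn_ord.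
  by move=> k tk _; rewrite leqNgt tk.
rewrite nneseries_interchange; last by move=> t k; case: ifP.
apply: eq_eseriesr => k _.
rewrite (nneseries_split _ k); last by move=> t _; case: ifP.
rewrite add0n big1_seq ?add0e.
  rewrite -(nneseries_addn (f := fun t => if (k <= t)%N then a k (t - k)%N else 0)); last first.
    by move=> t; case: ifP.
  by apply: eq_eseriesr => l _; rewrite leq_addl addnK.
by move=> t; rewrite mem_index_iota => /andP[_ /andP[_ tk]]; rewrite leqNgt tk.
Qed.

Lemma ge0_integralZl2 (c e : R) f : (0 <= c)%R -> (0 <= e)%R ->
  measurable_fun setT f -> (forall x, 0 <= f x) ->
  \int[mu]_x (c%:E * (e%:E * f x)) = c%:E * (e%:E * \int[mu]_x f x).
Proof.
move=> c0 e0 mf f0; under eq_integral => x _ do rewrite muleA -EFinM.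
by rewrite ge0_integralZl ?lee_fin ?mulr_ge0// muleA.
Qed.

Section lam.
Variable lam : R.
Hypothesis lam0 : (0 <= lam)%R.
Variables g b : T -> \bar R.
Hypotheses (mg : measurable_fun setT g) (g0 : forall x, 0 <= g x).
Hypotheses (mb : measurable_fun setT b) (b0 : forall x, 0 <= b x).

Let coef0 k x : 0 <= x -> 0 <= (lam ^+ k)%:E * (((k`!%:R)^-1)%:E * x).
Proof. by move=> x0; rewrite !mule_ge0 ?lee_fin ?exprn_ge0 ?invr_ge0. Qed.

Lemma YpZ (c : R) Phi : (0 <= c)%R -> mfunctional Phi ->
  Yp lam (fun f => c%:E * Phi f) g b = c%:E * Yp lam Phi g b.
Proof.
move=> c0 mP; rewrite /Yp -nneseriesZl; last by move=> k _; rewrite coef0// ys_ge0.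
apply: eq_eseriesr => k _; rewrite ysZ//.
by rewrite [RHS]muleCA [in RHS](muleCA c%:E).
Qed.

Lemma YpD Phi Psi : mfunctional Phi -> mfunctional Psi ->
  Yp lam (fun f => Phi f + Psi f) g b = Yp lam Phi g b + Yp lam Psi g b.
Proof.
move=> mP mQ; rewrite /Yp -nneseriesD.
- by apply: eq_eseriesr => k _; rewrite ysD// !ge0_muleDr// ?mule_ge0// ?lee_fin ?invr_ge0// ys_ge0.
- by move=> k _ _; rewrite coef0// ys_ge0.
- by move=> k _ _; rewrite coef0// ys_ge0.
Qed.

Lemma Yp1 : Yp lam (fun=> 1) g b = Zp lam g.
Proof. by apply: eq_eseriesr => k _; rewrite ys1. Qed.

Lemma Yp_pick Phi : mfunctional Phi ->
  \int[mu]_x (b x * Yp lam Phi (link g x) (link b x)) = Yp lam (pick Phi) g b.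
Proof.
move=> mP.
have Y0 k x : 0 <= ys Phi k (link g x) (link b x).
  rewrite ys_ge0//; exact: link_ge0.
have mY k : measurable_fun setT (fun x => ys Phi k (link g x) (link b x)).
  exact: measurable_ys_link.
under eq_integral => x _.
  rewrite /Yp ge0_nneseriesZl//; last by move=> k; rewrite coef0.
  over.
rewrite integral_nneseries//.
- apply: eq_eseriesr => k _; rewrite -ys_pick//.
  rewrite -ge0_integralZl2 ?exprn_ge0 ?invr_ge0//.
  + by apply: eq_integral => x _; rewrite muleCA (muleCA (b x)).
  + exact: emeasurable_funM.
  + by move=> x; rewrite mule_ge0.
- by move=> k; apply: emeasurable_funM => //; do 2 apply: measurable_funeM.
- by move=> k x _; rewrite mule_ge0// coef0.
Qed.

(** The spatial Markov property, without normalisation. Since [C(t, k) / t! = 1 / (k! (t - k)!)],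
    the binomial expansion [hsD] splits the series in [t] into a double series over outer and inner
    points. *)
Lemma ZpD : Zp lam (fun x => g x + b x) = Yp lam (Zp lam) g b.
Proof.
pose a k l := (lam ^+ k)%:E * (((k`!%:R)^-1)%:E *
  ((lam ^+ l)%:E * (((l`!%:R)^-1)%:E * ys (hs l) k g b))).
have mh' l := mfunctional_hs l.
have mz l : mfunctional (fun f => (lam ^+ l)%:E * zc l f).
  by apply: mfunctionalZ; rewrite ?exprn_ge0//; exact: mfunctional_zc.
transitivity (\sum_(0 <= t <oo) \sum_(k < t.+1) a k (t - k)%N).
  apply: eq_eseriesr => t _; rewrite /zc hsD// muleA -EFinM.
  rewrite ge0_sume_distrr; last by move=> k _; rewrite mule_ge0 ?lee_fin ?ys_ge0.
  apply: eq_bigr => k _; rewrite /a !muleA -!EFinM; congr (_%:E * _).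
  have kt : (k <= t)%N by rewrite -ltnS ltn_ord.
  have f0 n : n`!%:R != 0%R :> R by rewrite pnatr_eq0 -lt0n fact_gt0.
  rewrite -[X in (lam ^+ X)%R](subnKC kt) exprD -(bin_fact kt) !natrM.
  have := f0 k; have := f0 (t - k)%N.
  have : 'C(t, k)%:R != 0%R :> R by rewrite pnatr_eq0 -lt0n bin_gt0.
  move: (_%:R) (_%:R) (_%:R) => u v w u0 v0 w0.
  by field; rewrite u0 v0 w0.
rewrite nneseries_triangle; last first.
  by move=> k l; rewrite coef0// coef0// ys_ge0.
apply: eq_eseriesr => k _.
rewrite ys_nneseries// -nneseriesZl; last by move=> l _; rewrite ys_ge0.
rewrite -nneseriesZl; last first.
  by move=> l _; rewrite mule_ge0 ?lee_fin ?invr_ge0// ys_ge0.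
apply: eq_eseriesr => l _; congr (_ * (_ * _)).
rewrite ysZ ?exprn_ge0//; last exact: mfunctional_zc.
by rewrite /zc ysZ ?invr_ge0.
Qed.

End lam.

(** Singling out one of [t] points turns [t / t!] into [1 / (t - 1)!], and the remaining points form
    a configuration of weight [link f x] (the Mecke formula). *)
Lemma mom_pick lam f : (0 <= lam)%R -> measurable_fun setT f ->
  (forall x, 0 <= f x) -> mom lam f = lam%:E * pick (Zp lam) f.
Proof.
move=> l0 mf f0.
have H0 t x : 0 <= hs t (link f x) by apply: (mfunctional_hs t).1; exact: link_ge0.
have mH t : measurable_fun setT (fun x => hs t (link f x)).
  apply: ((mfunctional_hs t).2 _ T (fun z => link f z.1 z.2)).
  - exact: measurable_link.
  - by move=> w; apply: link_ge0.
rewrite /mom nneseries_recl//; last first.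
  by move=> k _; rewrite mule_ge0 ?lee_fin ?mulr_ge0 ?exprn_ge0// zc_ge0.
rewrite !mul0r mul0e add0e -nneseries_addn; last first.
  by move=> k; rewrite mule_ge0 ?lee_fin ?mulr_ge0 ?exprn_ge0// zc_ge0.
transitivity (lam%:E * \sum_(0 <= t <oo) (lam ^+ t)%:E * (((t`!%:R)^-1)%:E *
    \int[mu]_x (f x * hs t (link f x)))).
  have I0 t : 0 <= \int[mu]_x (f x * hs t (link f x)).
    by apply: integral_ge0 => x _; rewrite mule_ge0.
  rewrite -nneseriesZl; last first.
    by move=> t _; rewrite !mule_ge0 ?lee_fin ?exprn_ge0 ?invr_ge0.
  apply: eq_eseriesr => t _; rewrite addn1 /zc hsS /pick !muleA -!EFinM.
  congr (_%:E * _); rewrite factS natrM exprS.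
  have t1 : t.+1%:R != 0%R :> R by rewrite pnatr_eq0.
  have t2 : t`!%:R != 0%R :> R by rewrite pnatr_eq0 -lt0n fact_gt0.
  move: (t.+1%:R) (t`!%:R) t1 t2 => u v u0 v0.
  by field; rewrite u0 v0.
congr (_ * _).
under [RHS]eq_integral => x _.
  rewrite /Zp ge0_nneseriesZl//; last first.
    by move=> k; rewrite mule_ge0 ?lee_fin ?exprn_ge0// zc_ge0//; exact: link_ge0.
  over.
rewrite integral_nneseries//.
- apply: eq_eseriesr => k _; rewrite -ge0_integralZl2 ?exprn_ge0 ?invr_ge0//.
  + by apply: eq_integral => x _; rewrite /zc [RHS]muleCA (muleCA (f x)).
  + exact: emeasurable_funM.
  + by move=> x; rewrite mule_ge0.
- by move=> k; apply: emeasurable_funM => //; do 2 apply: measurable_funeM.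
- move=> k x _; rewrite mule_ge0// mule_ge0 ?lee_fin ?exprn_ge0// zc_ge0//.
  exact: link_ge0.
Qed.

(** Integrating over inner points the partition function of the whole weight amounts to averaging
    [pick] of the unblocked inner part: the Markov property under the integral, then [Yp_pick]. *)
Lemma pick_ZpD lam g b : (0 <= lam)%R ->
  measurable_fun setT g -> (forall x, 0 <= g x) ->
  measurable_fun setT b -> (forall x, 0 <= b x) ->
  \int[mu]_x (b x * Zp lam (link (fun y => g y + b y) x)) = Yp lam (pick (Zp lam)) g b.
Proof.
move=> l0 mg g0 mb b0; rewrite -(Yp_pick l0 mg g0 mb b0 (mfunctional_Zp l0)).
apply: eq_integral => x _; rewrite linkD// ZpD//.
- exact: measurable_link1.
- exact: link_ge0.
- exact: measurable_link1.
- exact: link_ge0.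
Qed.

(** * Inequalities for a pair factor with a nonnegative complement *)

Variable hc : T -> T -> \bar R.
Hypothesis mhc : measurable_fun setT (fun z : T * T => hc z.1 z.2).
Hypothesis hc0 : forall x y, 0 <= hc x y.
Hypothesis hcsym : forall x y, hc x y = hc y x.
Hypothesis hhc : forall x y, h x y + hc x y = 1.

Lemma link_le (f : T -> \bar R) x y : (forall y, 0 <= f y) -> link f x y <= f y.
Proof. by move=> f0; rewrite /link -[leRHS]mule1 lee_wpmul2l// -(hhc x y) leeDl. Qed.

Lemma hs_le (a : R) t f : (0 <= a)%R -> measurable_fun setT f ->
  (forall x, 0 <= f x) -> \int[mu]_x f x <= a%:E -> hs t f <= (a ^+ t)%:E.
Proof.
move=> a0; elim: t f => [//|t IH] f mf f0 fa.
rewrite hsS /pick exprSr EFinM.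
apply: (@le_trans _ _ (\int[mu]_x (f x * (a ^+ t)%:E))).
  apply: ge0_le_integral => //.
  - move=> x _; rewrite mule_ge0//; apply: (mfunctional_hs t).1; exact: link_ge0.
  - apply: emeasurable_funM => //.
    apply: ((mfunctional_hs t).2 _ T (fun z => link f z.1 z.2)).
    + exact: measurable_link.
    + by move=> w; apply: link_ge0.
  - exact: emeasurable_funM.
  - move=> x _; rewrite lee_wpmul2l// IH//; first exact: measurable_link1.
      exact: link_ge0.
    apply: le_trans fa; apply: ge0_le_integral => //.
    + by move=> y _; exact: link_ge0.
    + exact: measurable_link1.
    + by move=> y _; exact: link_le.
by rewrite ge0_integralZr ?lee_fin ?exprn_ge0// muleC lee_wpmul2l ?lee_fin ?exprn_ge0.
Qed.

Lemma nneseries_exp (x : R) : (0 <= x)%R ->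
  \sum_(0 <= t <oo) (exp_coeff x t)%:E = (expR x)%:E.
Proof.
move=> x0; rewrite /expR -EFin_lim; last exact: is_cvg_series_exp_coeff.
by apply/congr_lim/funext => n; rewrite /= /series/= sumEFin.
Qed.

Lemma Zp_le_exp (lam a : R) f : (0 <= lam)%R -> (0 <= a)%R -> measurable_fun setT f ->
  (forall x, 0 <= f x) -> \int[mu]_x f x <= a%:E -> Zp lam f <= (expR (lam * a))%:E.
Proof.
move=> l0 a0 mf f0 fa; rewrite -nneseries_exp ?mulr_ge0//.
apply: lee_nneseries => [t _ _|t _].
  by rewrite mule_ge0 ?lee_fin ?exprn_ge0// zc_ge0.
rewrite /zc /exp_coeff/= exprMn -mulrA EFinM lee_wpmul2l ?lee_fin ?exprn_ge0//.
by rewrite mulrC EFinM lee_wpmul2l ?lee_fin ?invr_ge0// hs_le.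
Qed.

(** Linking only decreases a weight, so the comparison of [Phi] and [Psi] is asked for on weights
    below [b]. This lets local estimates enter. *)
Lemma ys_le Phi Psi k g b : mfunctional Phi -> mfunctional Psi ->
  measurable_fun setT g -> (forall x, 0 <= g x) ->
  measurable_fun setT b -> (forall x, 0 <= b x) ->
  (forall b', measurable_fun setT b' -> (forall x, 0 <= b' x <= b x) ->
    Phi b' <= Psi b') ->
  ys Phi k g b <= ys Psi k g b.
Proof.
move=> mP mQ; elim: k g b => [|k IH] g b mg g0 mb b0 PQ /=.
  by apply: PQ => // x; rewrite b0 lexx.
apply: ge0_le_integral => //.
- move=> x _; rewrite mule_ge0// ys_ge0//; exact: link_ge0.
- by apply: emeasurable_funM => //; exact: measurable_ys_link.
- by apply: emeasurable_funM => //; exact: measurable_ys_link.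
- move=> x _; rewrite lee_wpmul2l// IH//.
  + exact: measurable_link1.
  + exact: link_ge0.
  + exact: measurable_link1.
  + exact: link_ge0.
  + move=> b' mb' b'0; apply: PQ => // y.
    by case/andP: (b'0 y) => -> /le_trans -> //; exact: link_le.
Qed.

Lemma Yp_le lam Phi Psi g b : (0 <= lam)%R -> mfunctional Phi -> mfunctional Psi ->
  measurable_fun setT g -> (forall x, 0 <= g x) ->
  measurable_fun setT b -> (forall x, 0 <= b x) ->
  (forall b', measurable_fun setT b' -> (forall x, 0 <= b' x <= b x) ->
    Phi b' <= Psi b') ->
  Yp lam Phi g b <= Yp lam Psi g b.
Proof.
move=> l0 mP mQ mg g0 mb b0 PQ; apply: lee_nneseries => [k _ _|k _].
  by rewrite !mule_ge0 ?lee_fin ?exprn_ge0 ?invr_ge0// ys_ge0.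
by do 2 (rewrite lee_wpmul2l ?lee_fin ?exprn_ge0 ?invr_ge0//); exact: ys_le.
Qed.

(** By the Markov property the left side averages partition functions of parts of [b], each at most
    [expR (lam * a)], and the average of 1 is [Zp lam g]. *)
Lemma Zp_subadd (lam a : R) g b : (0 <= lam)%R -> (0 <= a)%R ->
  measurable_fun setT g -> (forall x, 0 <= g x) ->
  measurable_fun setT b -> (forall x, 0 <= b x) -> \int[mu]_x b x <= a%:E ->
  Zp lam (fun x => g x + b x) <= (expR (lam * a))%:E * Zp lam g.
Proof.
move=> l0 a0 mg g0 mb b0 ba; rewrite ZpD//.
have m1 := mfunctional_cst (@lee01 R).
rewrite -(Yp1 lam g b) -YpZ ?expR_ge0//.
apply: Yp_le => //.
- exact: mfunctional_Zp.
- move=> b' mb' bb; rewrite mule1; apply: Zp_le_exp => //.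
    by move=> x; case/andP: (bb x).
  apply: le_trans ba; apply: ge0_le_integral => // x _.
    by case/andP: (bb x).
  by case/andP: (bb x).
Qed.

(** The part of [f] that [x] blocks, the overview's set of points of [T] outside [T_u]. *)
Definition clink (f : T -> \bar R) (x : T) : T -> \bar R := fun y => f y * hc x y.

Lemma link_clink f x y : f y = link f x y + clink f x y.
Proof. by rewrite /link /clink -ge0_muleDr// hhc mule1. Qed.

Lemma clink_ge0 f x : (forall y, 0 <= f y) -> forall y, 0 <= clink f x y.
Proof. by move=> f0 y; rewrite mule_ge0. Qed.

Lemma measurable_clink (g : T -> \bar R) : measurable_fun setT g ->
  measurable_fun setT (fun z : T * T => clink g z.1 z.2).
Proof.
move=> mg; apply: (emeasurable_funM (f := fun z : T * T => g z.2)) => //.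
exact: measurableT_comp.
Qed.

Lemma measurable_clink1 (g : T -> \bar R) x : measurable_fun setT g ->
  measurable_fun setT (clink g x).
Proof. by move=> mg; exact: (measurable_fun_pair2 x (measurable_clink mg)). Qed.

Lemma measurable_Zp_link lam f : (0 <= lam)%R -> measurable_fun setT f ->
  (forall x, 0 <= f x) -> measurable_fun setT (fun x => Zp lam (link f x)).
Proof.
move=> l0 mf f0.
apply: ((mfunctional_Zp l0).2 _ T (fun z => link f z.1 z.2)).
- exact: measurable_link.
- by move=> w; apply: link_ge0.
Qed.

Lemma measurable_int_clink f : measurable_fun setT f ->
  (forall x, 0 <= f x) -> measurable_fun setT (fun x => \int[mu]_y clink f x y).
Proof.
move=> mf f0.
apply: (measurable_fun_fubini_tonelli_F (m2 := mu) (fun z => clink f z.1 z.2)).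
- exact: measurable_clink.
- by move=> w; apply: clink_ge0.
Qed.

(** If [u] blocks mass [w], then [Z_T <= exp(lam w) Z_(T_u)], hence [Z_(T_u) >= (1 - lam w) Z_T] by
    [exp(-s) >= 1 - s]. Integrating over [u] in [T] bounds the total blocked mass by [E * beta]. *)
Lemma pick_Zp_lb (lam beta E : R) b : (0 <= lam)%R -> (0 <= E)%R ->
  measurable_fun setT b -> (forall x, 0 <= b x) -> \int[mu]_x b x = beta%:E ->
  \int[mu]_x (b x * \int[mu]_y clink b x y) <= (E * beta)%:E ->
  beta%:E * Zp lam b <= pick (Zp lam) b + (lam * E * beta)%:E * Zp lam b.
Proof.
move=> l0 E0 mb b0 bE bb.
have beta0 : (0 <= beta)%R by rewrite -lee_fin -bE integral_ge0.
have Z0 f : (forall x, 0 <= f x) -> 0 <= Zp lam f.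
  by move=> f0; exact: (mfunctional_Zp l0).1.
have cl0 x : 0 <= \int[mu]_y clink b x y by apply: integral_ge0 => y _; exact: clink_ge0.
have cl_le x : \int[mu]_y clink b x y <= beta%:E.
  rewrite -bE; apply: ge0_le_integral => //.
  - by move=> y _; exact: clink_ge0.
  - exact: measurable_clink1.
  - by move=> y _; rewrite (link_clink b x y) leeDr// link_ge0.
have Zfin : Zp lam b \is a fin_num.
  rewrite ge0_fin_numE ?Z0//; apply: le_lt_trans (ltry _).
  by apply: (Zp_le_exp l0 beta0 mb b0); rewrite bE.
have main x : Zp lam b <= Zp lam (link b x) + (lam%:E * Zp lam b) * \int[mu]_y clink b x y.
  have wfin : \int[mu]_y clink b x y \is a fin_num.
    by rewrite ge0_fin_numE//; apply: le_lt_trans (cl_le x) (ltry _).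
  have [w wE] : exists w, \int[mu]_y clink b x y = w%:E by exists (fine (\int[mu]_y clink b x y)); rewrite fineK.
  have w0 : (0 <= w)%R by rewrite -lee_fin -wE.
  have : Zp lam b <= (expR (lam * w))%:E * Zp lam (link b x).
    rewrite {1}(_ : b = fun y => link b x y + clink b x y); last first.
      by apply/funext => y; exact: link_clink.
    apply: Zp_subadd => //.
    - exact: measurable_link1.
    - exact: link_ge0.
    - exact: measurable_clink1.
    - exact: clink_ge0.
    - by rewrite wE.
  rewrite wE; move: (Z0 _ (link_ge0 x b0)); case: (Zp lam (link b x)) => [z z0|_ _|//]; last first.
    by rewrite addye ?leey//; rewrite -(fineK Zfin).
  rewrite -(fineK Zfin) -!EFinM -EFinD !lee_fin; set Z := fine _ => Zz.
  have e1 : (1 - lam * w <= expR (- (lam * w)))%R by rewrite expR_ge1Dx.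
  have Zge : (0 <= Z)%R by rewrite fine_ge0// Z0.
  have : (Z * expR (- (lam * w)) <= z)%R.
    by rewrite expRN ler_pdivrMr ?expR_gt0// mulrC.
  have := ler_wpM2l Zge e1.
  lra.
have -> : beta%:E * Zp lam b = \int[mu]_x (b x * Zp lam b).
  by rewrite ge0_integralZr ?Z0// bE.
apply: (@le_trans _ _ (\int[mu]_x (b x * Zp lam (link b x) +
    (lam%:E * Zp lam b) * (b x * \int[mu]_y clink b x y)))).
  apply: ge0_le_integral => //.
  - by move=> x _; rewrite mule_ge0// Z0.
  - exact: emeasurable_funM.
  - apply: emeasurable_funD; first by apply: emeasurable_funM => //; exact: measurable_Zp_link.
    by apply: measurable_funeM; apply: emeasurable_funM => //; exact: measurable_int_clink.
  - move=> x _; rewrite muleCA -ge0_muleDr//; last by rewrite mule_ge0// mule_ge0 ?lee_fin ?Z0.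
      by rewrite lee_wpmul2l.
    by apply: Z0; exact: link_ge0.
rewrite ge0_integralD//; last 4 first.
- by move=> x _; rewrite mule_ge0// Z0//; exact: link_ge0.
- by apply: emeasurable_funM => //; exact: measurable_Zp_link.
- by move=> x _; rewrite !mule_ge0 ?lee_fin ?Z0.
- by apply: measurable_funeM; apply: emeasurable_funM => //; exact: measurable_int_clink.
apply: leeD => //; rewrite ge0_integralZl//.
- rewrite -mulrA EFinM -!muleA lee_wpmul2l ?lee_fin// [leRHS]muleC.
  by rewrite lee_wpmul2l ?Z0.
- by apply: emeasurable_funM => //; exact: measurable_int_clink.
- by move=> x _; rewrite mule_ge0.
- by rewrite mule_ge0 ?lee_fin ?Z0.
Qed.

(** The convex function [z ln z] lies above its tangent at [W]. Used inside a linear average, this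
    takes the place of Jensen's inequality. *)
Lemma ln_tangent (z W : R) : (0 < z)%R -> (0 < W)%R ->
  (z * (1 + ln W) <= z * ln z + W)%R.
Proof.
move=> z0 W0; have Wz : (0 < W / z)%R by rewrite divr_gt0.
have := ln_le_subr1 Wz; rewrite ln_div ?posrE// => H.
have := ler_wpM2l (ltW z0) H.
rewrite !mulrBr mulr1 mulrCA divff ?gt_eqF// mulr1.
lra.
Qed.

(** Combines [pick_Zp_lb], [ln Z <= lam * beta] and the tangent. The final factor 1 stands for the
    constant functional, whose average is the partition function of the outer weight. *)
Lemma pick_Zp_entropy (lam beta E W : R) b : (0 <= lam)%R -> (0 <= E)%R ->
  (lam * E <= 1)%R -> (1 <= W)%R ->
  measurable_fun setT b -> (forall x, 0 <= b x) -> \int[mu]_x b x = beta%:E ->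
  \int[mu]_x (b x * \int[mu]_y clink b x y) <= (E * beta)%:E ->
  ((1 - lam * E) * (1 + ln W))%:E * Zp lam b <=
    lam%:E * pick (Zp lam) b + ((1 - lam * E) * W)%:E * 1.
Proof.
move=> l0 E0 lE W1 mb b0 bE bb.
have beta0 : (0 <= beta)%R by rewrite -lee_fin -bE integral_ge0.
have Zle : Zp lam b <= (expR (lam * beta))%:E by apply: Zp_le_exp; rewrite ?bE.
have Zge : 1 <= Zp lam b by exact: Zp_ge1.
have Zfin : Zp lam b \is a fin_num.
  by rewrite ge0_fin_numE ?(le_trans _ Zge)//; apply: le_lt_trans Zle (ltry _).
have := pick_Zp_lb l0 E0 mb b0 bE bb.
have : 0 <= pick (Zp lam) b by apply: (mfunctional_pick (mfunctional_Zp l0)).1.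
rewrite -(fineK Zfin) lee_fin in Zle; rewrite -(fineK Zfin) lee_fin in Zge.
rewrite -(fineK Zfin); move: (fine (Zp lam b)) Zle Zge => z zle z1.
case: (pick (Zp lam) b) => [P|_ _|//]; last first.
  (* Here [pick] is infinite. For [lam = 0] the product [0 * +oo] is 0, and the claim follows from
     [Z <= 1] and [1 + ln W <= W]. *)
  move: l0; rewrite le_eqVlt => /orP[/eqP l0|l0].
    rewrite -l0 mul0e add0e mule1 -EFinM lee_fin mul0r subr0 !mul1r.
    have : (z <= 1)%R by move: zle; rewrite -l0 mul0r expR0.
    have := ln_tangent ltr01 (lt_le_trans ltr01 W1).
    rewrite ln1 mulr0 add0r mul1r => h1' h2'.
    by apply: le_trans h1'; rewrite ler_piMr ?addr_ge0 ?ln_ge0.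
  by rewrite gt0_muley ?lte_fin// addye ?leey.
rewrite mule1 -!EFinM -!EFinD !lee_fin => P0 Pz.
have z0 : (0 < z)%R by apply: lt_le_trans z1.
have lnz : (ln z <= lam * beta)%R by rewrite -ler_expR lnK.
have e0 : (0 <= 1 - lam * E)%R by rewrite subr_ge0.
have T1 := ler_wpM2l e0 (ln_tangent z0 (lt_le_trans ltr01 W1)).
have Q := ler_wpM2l e0 (ler_wpM2l (ltW z0) lnz).
have U := ler_wpM2l l0 Pz.
lra.
Qed.

Lemma link_clinkE f x : f = fun y => link f x y + clink f x y.
Proof. by apply/funext => y; exact: link_clink. Qed.

(** The entropy bound, averaged over the outer configuration and integrated over [x] against [f].
    Sparsity is assumed for every weight below [clink f x], since the unblocked part can be any of
    these; [K] bounds the mass within range of a point. *)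
Lemma Zp_pick_ineq (lam K E V W : R) f : (0 <= lam)%R -> (0 <= K)%R -> (0 <= E)%R ->
  (lam * E <= 1)%R -> (1 <= W)%R ->
  measurable_fun setT f -> (forall x, 0 <= f x) -> \int[mu]_x f x = V%:E ->
  (forall x, \int[mu]_y clink f x y <= K%:E) ->
  (forall x b, measurable_fun setT b -> (forall y, 0 <= b y <= clink f x y) ->
    \int[mu]_u (b u * \int[mu]_y clink b u y) <= E%:E * \int[mu]_y b y) ->
  ((1 - lam * E) * (1 + ln W) * V)%:E * Zp lam f <=
    (lam * K + (1 - lam * E) * W)%:E * pick (Zp lam) f.
Proof.
move=> l0 K0 E0 lE W1 mf f0 fV fK fE.
have V0 : (0 <= V)%R by rewrite -lee_fin -fV integral_ge0.
have e0 : (0 <= 1 - lam * E)%R by rewrite subr_ge0.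
have lnW : (0 <= 1 + ln W)%R by rewrite addr_ge0// ln_ge0.
have mZ := mfunctional_Zp l0.
have Z0 g : (forall x, 0 <= g x) -> 0 <= Zp lam g by exact: mZ.1.
pose N x := \int[mu]_y (clink f x y * Zp lam (link f y)).
have N0 x : 0 <= N x.
  apply: integral_ge0 => y _; rewrite mule_ge0//; first exact: clink_ge0.
  by apply: Z0; exact: link_ge0.
pose F (z : T * T) := f z.1 * (clink f z.1 z.2 * Zp lam (link f z.2)).
have mcZ : measurable_fun setT (fun z : T * T => clink f z.1 z.2 * Zp lam (link f z.2)).
  apply: emeasurable_funM; first exact: measurable_clink.
  by apply: (measurableT_comp (measurable_Zp_link l0 mf f0)).
have cZ0 z : 0 <= clink f z.1 z.2 * Zp lam (link f z.2).
  rewrite mule_ge0//; first exact: clink_ge0.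
  by apply: Z0; exact: link_ge0.
have mN : measurable_fun setT N.
  exact: (measurable_fun_fubini_tonelli_F (m2 := mu) _ mcZ cZ0).
have main x : ((1 - lam * E) * (1 + ln W))%:E * Zp lam f <=
    lam%:E * N x + ((1 - lam * E) * W)%:E * Zp lam (link f x).
  have mg := measurable_link1 x mf; have g0 := link_ge0 x f0.
  have mc := measurable_clink1 x mf; have c0 := clink_ge0 x f0.
  have m1 : mfunctional (fun=> 1) := mfunctional_cst lee01.
  have mp := mfunctional_pick mZ.
  (* All three terms become averages over the outer configuration, of weight [link f x], with the
     constants moved inside. Monotonicity of [Yp] then leaves the entropy bound for a single
     unblocked part [b]. *)
  rewrite {1}(link_clinkE f x) (ZpD l0 mg g0 mc c0) -(YpZ l0 mg g0 mc c0 _ mZ) ?mulr_ge0//.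
  have -> : N x = Yp lam (pick (Zp lam)) (link f x) (clink f x).
    by rewrite -(pick_ZpD l0 mg g0 mc c0) -link_clinkE.
  rewrite -(Yp1 lam (link f x) (clink f x)) -(YpZ l0 mg g0 mc c0 l0 mp).
  rewrite -(YpZ l0 mg g0 mc c0 _ m1) ?mulr_ge0 ?(le_trans _ W1)//.
  rewrite -(YpD l0 mg g0 mc c0); last 2 first.
  - exact: mfunctionalZ.
  - by apply: (mfunctionalZ (Phi := fun=> 1)); rewrite ?mulr_ge0 ?(le_trans _ W1).
  apply: Yp_le => //.
  - by apply: mfunctionalZ => //; rewrite mulr_ge0.
  - apply: mfunctionalD; first exact: mfunctionalZ.
    by apply: (mfunctionalZ (Phi := fun=> 1)); rewrite ?mulr_ge0 ?(le_trans _ W1).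
  move=> b mb bb.
  have b0 y : 0 <= b y by case/andP: (bb y).
  have bV : \int[mu]_y b y <= V%:E.
    rewrite -fV; apply: ge0_le_integral => // y _.
    case/andP: (bb y) => _ /le_trans -> //.
    by rewrite [leRHS](link_clink f x y) leeDr.
  have bfin : \int[mu]_y b y \is a fin_num.
    by rewrite ge0_fin_numE ?integral_ge0//; apply: le_lt_trans bV (ltry _).
  apply: (pick_Zp_entropy (beta := fine (\int[mu]_y b y))) => //.
    by rewrite fineK.
  by rewrite EFinM fineK// (fE x).
have -> : ((1 - lam * E) * (1 + ln W) * V)%:E * Zp lam f =
    \int[mu]_x (f x * (((1 - lam * E) * (1 + ln W))%:E * Zp lam f)).
  rewrite ge0_integralZr ?fV//; last by rewrite mule_ge0 ?lee_fin ?mulr_ge0 ?Z0.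
  by rewrite muleA -EFinM [(V * _)%R]mulrC.
apply: (@le_trans _ _ (\int[mu]_x (lam%:E * (f x * N x) +
   ((1 - lam * E) * W)%:E * (f x * Zp lam (link f x))))).
  apply: ge0_le_integral => //.
  - by move=> x _; rewrite !mule_ge0 ?lee_fin ?mulr_ge0 ?Z0.
  - exact: emeasurable_funM.
  - apply: emeasurable_funD; apply: measurable_funeM; apply: emeasurable_funM => //.
    exact: measurable_Zp_link.
  - move=> x _; rewrite [lam%:E * _]muleCA [_ * (f x * Zp _ _)]muleCA -ge0_muleDr.
    + by rewrite lee_wpmul2l.
    + by rewrite mule_ge0 ?lee_fin.
    + by rewrite mule_ge0 ?lee_fin ?mulr_ge0 ?(le_trans _ W1)// Z0//; exact: link_ge0.
rewrite ge0_integralD//; last 4 first.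
- by move=> x _; rewrite !mule_ge0 ?lee_fin.
- by apply: measurable_funeM; apply: emeasurable_funM.
- move=> x _; rewrite !mule_ge0 ?lee_fin ?mulr_ge0 ?(le_trans _ W1)// Z0//; exact: link_ge0.
- by apply: measurable_funeM; apply: emeasurable_funM => //; exact: measurable_Zp_link.
have P0 : 0 <= pick (Zp lam) f by exact: (mfunctional_pick mZ).1.
rewrite EFinD ge0_muleDl ?lee_fin ?mulr_ge0 ?(le_trans _ W1)//.
apply: leeD; last first.
  rewrite ge0_integralZl ?lee_fin ?mulr_ge0 ?(le_trans _ W1)//.
    by apply: emeasurable_funM => //; exact: measurable_Zp_link.
  by move=> x _; rewrite mule_ge0// Z0//; exact: link_ge0.
rewrite ge0_integralZl//; last 2 first.
- exact: emeasurable_funM.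
- by move=> x _; rewrite mule_ge0.
rewrite EFinM -muleA lee_wpmul2l ?lee_fin//.
have F0 z : 0 <= F z by rewrite mule_ge0.
have mF : measurable_fun setT F.
  by apply: emeasurable_funM => //; exact: measurableT_comp.
(* Double counting: for fixed [y], the points [x] that have [y] in range carry mass at most [K]. *)
have -> : \int[mu]_x (f x * N x) = \int[mu]_x \int[mu]_y F (x, y).
  apply: eq_integral => x _; rewrite -ge0_integralZl//.
    apply: emeasurable_funM; first exact: measurable_clink1.
    exact: measurable_Zp_link.
  by move=> y _; exact: (cZ0 (x, y)).
rewrite fubini_tonelli// -ge0_integralZl//; last 2 first.
- by apply: emeasurable_funM => //; exact: measurable_Zp_link.
- by move=> x _; rewrite mule_ge0// Z0//; exact: link_ge0.
apply: ge0_le_integral => //.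
- by move=> y _; apply: integral_ge0 => x _; exact: F0.
- exact: (measurable_fun_fubini_tonelli_G (m1 := mu) _ mF F0).
- by apply: measurable_funeM; apply: emeasurable_funM => //; exact: measurable_Zp_link.
move=> y _.
have -> : \int[mu]_x F (x, y) = (f y * Zp lam (link f y)) * \int[mu]_x clink f y x.
  rewrite -ge0_integralZl//.
  - apply: eq_integral => x _; rewrite /F /= /clink (hcsym x y) [RHS]muleACA.
    rewrite [f y * f x]muleC -[RHS]muleA; congr (_ * _).
    by rewrite [Zp _ _ * _]muleC muleA.
  - exact: measurable_clink1.
  - by move=> x _; exact: clink_ge0.
  - by rewrite mule_ge0// Z0//; exact: link_ge0.
by rewrite muleC lee_wpmul2r// mule_ge0// Z0//; exact: link_ge0.
Qed.

Lemma Zp_fin (lam V : R) f : (0 <= lam)%R -> measurable_fun setT f ->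
  (forall x, 0 <= f x) -> \int[mu]_x f x = V%:E -> Zp lam f \is a fin_num.
Proof.
move=> l0 mf f0 fV.
have V0 : (0 <= V)%R by rewrite -lee_fin -fV integral_ge0.
rewrite ge0_fin_numE; last exact: (mfunctional_Zp l0).1.
by apply: le_lt_trans (ltry (expR (lam * V))); apply: Zp_le_exp; rewrite ?fV.
Qed.

Lemma mom_fin (lam V : R) f : (0 <= lam)%R -> measurable_fun setT f ->
  (forall x, 0 <= f x) -> \int[mu]_x f x = V%:E -> mom lam f \is a fin_num.
Proof.
move=> l0 mf f0 fV.
have V0 : (0 <= V)%R by rewrite -lee_fin -fV integral_ge0.
have Z0 := (mfunctional_Zp l0).1 f f0.
rewrite mom_pick// fin_numM// ge0_fin_numE; last first.
  exact: (mfunctional_pick (mfunctional_Zp l0)).1.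
apply: (@le_lt_trans _ _ (V%:E * (expR (lam * V))%:E)); last by rewrite -EFinM ltry.
rewrite -fV -ge0_integralZr ?lee_fin ?expR_ge0//.
apply: ge0_le_integral => //.
- move=> x _; rewrite mule_ge0//; apply: (mfunctional_Zp l0).1; exact: link_ge0.
- by apply: emeasurable_funM => //; exact: measurable_Zp_link.
- exact: emeasurable_funM.
- move=> x _; rewrite lee_wpmul2l//; apply: Zp_le_exp => //.
  + exact: measurable_link1.
  + exact: link_ge0.
  + rewrite -fV; apply: ge0_le_integral => //.
    * by move=> y _; exact: link_ge0.
    * exact: measurable_link1.
    * by move=> y _; exact: link_le.
Qed.

(** Linking preserves equality almost everywhere, so induction on [t] applies. This identifies the
    configuration integrals of the two Borel sets enclosing [S]. *)
Lemma hs_ae t f g : measurable_fun setT f -> (forall x, 0 <= f x) ->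
  measurable_fun setT g -> (forall x, 0 <= g x) ->
  {ae mu, forall x, f x = g x} -> hs t f = hs t g.
Proof.
move=> + + + + fg; have ae_link (u v : T -> \bar R) x :
    {ae mu, forall y, u y = v y} -> {ae mu, forall y, link u x y = link v x y}.
  by apply: filterS => y uv; rewrite /link uv.
have mH k u : measurable_fun setT u -> (forall x, 0 <= u x) ->
    measurable_fun setT (fun x => hs k (link u x)).
  move=> mu0 u0; apply: ((mfunctional_hs k).2 _ T (fun z => link u z.1 z.2)).
    exact: measurable_link.
  by move=> w; apply: link_ge0.
elim: t f g fg => [//|t IH] f g fg mf f0 mg g0; rewrite !hsS /pick.
transitivity (\int[mu]_x (f x * hs t (link g x))).
  apply: eq_integral => x _; congr (_ * _); apply: IH.
  - exact: ae_link.
  - exact: measurable_link1.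
  - exact: link_ge0.
  - exact: measurable_link1.
  - exact: link_ge0.
apply: ae_eq_integral => //.
- by apply: emeasurable_funM => //; exact: mH.
- by apply: emeasurable_funM => //; exact: mH.
- by apply: filterS fg => x fgx _; rewrite fgx.
Qed.

Definition density (lam : R) f : R :=
  (fine (mom lam f) / fine (Zp lam f) / fine (\int[mu]_x f x))%R.

Lemma density_ineq (lam K E V W : R) f : (0 < lam)%R -> (0 <= K)%R -> (0 <= E)%R ->
  (lam * E <= 1)%R -> (1 <= W)%R ->
  measurable_fun setT f -> (forall x, 0 <= f x) -> (0 < V)%R ->
  \int[mu]_x f x = V%:E ->
  (forall x, \int[mu]_y clink f x y <= K%:E) ->
  (forall x b, measurable_fun setT b -> (forall y, 0 <= b y <= clink f x y) ->
    \int[mu]_u (b u * \int[mu]_y clink b u y) <= E%:E * \int[mu]_y b y) ->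
  ((1 - lam * E) * (1 + ln W) <= (K + (1 - lam * E) * (W / lam)) * density lam f)%R.
Proof.
move=> l0 K0 E0 lE W1 mf f0 V0 fV fK fE.
have l0' := ltW l0.
have := Zp_pick_ineq l0' K0 E0 lE W1 mf f0 fV fK fE.
have := mom_pick l0' mf f0.
have := mom_fin l0' mf f0 fV; have := Zp_fin l0' mf f0 fV.
have := Zp_ge1 l0' f0.
have := (mfunctional_pick (mfunctional_Zp l0')).1 f f0.
rewrite /density fV /=.
case: (Zp lam f) => [z|//|//]; case: (mom lam f) => [m|//|//].
case: (pick (Zp lam) f) => [P|_ _ _ _|//]; last by rewrite gt0_muley ?lte_fin.
rewrite !lee_fin -!EFinM => P0 z1 _ _ [mE] H.
have z0 : (0 < z)%R by apply: lt_le_trans z1.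
rewrite mE /= mulrA mulrA ler_pdivlMr// ler_pdivlMr//.
rewrite [leRHS](_ : _ = (lam * K + (1 - lam * E) * W) * P)%R; first lra.
by field; rewrite gt_eqF.
Qed.

End GasFunctionals.

(** * Monotonicity of the mean number of points in the fugacity *)

Section SeriesRatio.
Context (R : realType).
Local Open Scope ereal_scope.

(* With m = M(l0)/Z(l0) and s = (l/l0)^m, each (t - m)(l^t - s l0^t) is
   nonnegative, and sum_t (t - m) l0^t a_t = 0. *)
Lemma nneseries_mean_mono (a : nat -> \bar R) (l0 l : R) :
  (forall t, 0 <= a t) -> (0 < l0 <= l)%R ->
  let Z x := \sum_(0 <= t <oo) (x ^+ t)%:E * a t in
  let M x := \sum_(0 <= t <oo) (t%:R * x ^+ t)%:E * a t in
  (forall x, (0 <= x)%R -> 1 <= Z x) ->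
  (forall x, (0 <= x)%R -> Z x \is a fin_num) ->
  (forall x, (0 <= x)%R -> M x \is a fin_num) ->
  (fine (M l0) / fine (Z l0) <= fine (M l) / fine (Z l))%R.
Proof.
move=> a0 /andP[l00 l0l] Z M Z1 Zf Mf.
have l0' := ltW l00; have ll : (0 < l)%R := lt_le_trans l00 l0l.
have M0 x : (0 <= x)%R -> 0 <= M x.
  by move=> x0; apply: nneseries_ge0 => t _ _; rewrite mule_ge0 ?lee_fin ?mulr_ge0 ?exprn_ge0.
have z0 x : (0 <= x)%R -> (0 < fine (Z x))%R.
  by move=> x0; rewrite -lte_fin fineK ?Zf// (lt_le_trans _ (Z1 x x0))// lte01.
pose m := (fine (M l0) / fine (Z l0))%R.
have m0 : (0 <= m)%R by apply: divr_ge0; [exact/fine_ge0/M0|exact/ltW/z0].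
pose s := ((l / l0) `^ m)%R.
have s0 : (0 <= s)%R by exact: powR_ge0.
have q1 : (1 <= l / l0)%R by rewrite ler_pdivlMr// mul1r.
have key (t : nat) : (m * l ^+ t + s * (t%:R * l0 ^+ t) <=
    t%:R * l ^+ t + m * s * l0 ^+ t)%R.
  have -> : (l ^+ t = (l / l0) `^ t%:R * l0 ^+ t)%R.
    by rewrite powR_mulrn ?(le_trans ler01)// -exprMn divfK ?gt_eqF.
  have L : (0 <= l0 ^+ t)%R by rewrite exprn_ge0.
  suff : (0 <= (t%:R - m) * ((l / l0) `^ t%:R - s) * l0 ^+ t)%R by lra.
  rewrite mulr_ge0//; have [mt|tm] := leP m t%:R.
    by rewrite mulr_ge0// subr_ge0// ler_powR.
  by rewrite mulr_le0// subr_le0 ?(ltW tm)// /s ler_powR// ltW.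
have sumD (c1 c2 : R) (u1 u2 : nat -> R) : (0 <= c1)%R -> (0 <= c2)%R ->
    (forall t, 0 <= u1 t)%R -> (forall t, 0 <= u2 t)%R ->
    c1%:E * (\sum_(0 <= t <oo) (u1 t)%:E * a t) +
    c2%:E * (\sum_(0 <= t <oo) (u2 t)%:E * a t) =
    \sum_(0 <= t <oo) (c1 * u1 t + c2 * u2 t)%:E * a t.
  move=> c10 c20 u10 u20.
  rewrite -!nneseriesZl; try by move=> t _; rewrite mule_ge0 ?lee_fin.
  rewrite -nneseriesD; try by move=> t _ _; rewrite !mule_ge0 ?lee_fin.
  apply: eq_eseriesr => t _.
  by rewrite !muleA -!EFinM -ge0_muleDl ?lee_fin ?mulr_ge0.
have ineq : m%:E * Z l + s%:E * M l0 <= 1%:E * M l + (m * s)%:E * Z l0.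
  have t0 (x : R) (t : nat) : (0 <= x)%R -> (0 <= t%:R * x ^+ t)%R.
    by move=> x0; rewrite mulr_ge0// exprn_ge0.
  rewrite /Z /M !sumD//; try by move=> t; rewrite ?t0 ?exprn_ge0// ltW.
    apply: lee_nneseries => [t _ _|t _].
      by rewrite mule_ge0// lee_fin addr_ge0// mulr_ge0// ?t0// exprn_ge0// ltW.
    by rewrite lee_wpmul2r// lee_fin mul1r key.
  by rewrite mulr_ge0.
rewrite -/m ler_pdivlMr; last exact/z0/ltW.
move: ineq.
rewrite -(fineK (Zf l (ltW ll))) -(fineK (Zf l0 l0')) -(fineK (Mf l (ltW ll))).
rewrite -(fineK (Mf l0 l0')) -!EFinM -!EFinD lee_fin /=.
have -> : (m * s * fine (Z l0) = s * fine (M l0))%R.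
  by rewrite /m; field; rewrite gt_eqF// z0.
lra.
Qed.

End SeriesRatio.

(** * Uniform convexity of the block norm *)

Section UniformConvexity.
Context (R : realType).
Implicit Types (p q x y w : R).

(** Weighted AM-GM for [w] and 1: [ln v - ln s <= v / s - 1] is taken at [v = w] and [v = 1] with
    weights [q] and [1 - q]. As [s] is the weighted mean, the right sides cancel. *)
Lemma powR_le_tangent q w : 0 < w -> 0 <= q <= 1 -> w `^ q <= 1 + q * (w - 1).
Proof.
move=> w0 /andP[q0 q1].
pose s := 1 + q * (w - 1).
have s0 : 0 < s.
  have [q1'|q1'] := eqVneq q 1; first by rewrite /s q1' mul1r addrC subrK.
  have q1'' : q < 1 by rewrite lt_neqAle q1' q1.
  rewrite /s; nra.
have lnle v : 0 < v -> ln v - ln s <= v / s - 1.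
  move=> v0; rewrite -ln_div ?posrE//.
  by rewrite ln_le_subr1// divr_gt0.
have L1 := ler_wpM2l q0 (lnle w w0).
have q1' : 0 <= 1 - q by rewrite subr_ge0.
have L2 := ler_wpM2l q1' (lnle 1 ltr01).
have E : q * (w / s - 1) + (1 - q) * (1 / s - 1) = 0.
  by rewrite /s; field; rewrite -/s gt_eqF.
rewrite -ler_ln ?posrE ?powR_gt0// ln_powR -/s.
rewrite ln1 in L2; lra.
Qed.

(** Write [y^p = y * y^(p-1)] and apply the tangent bound for the exponent [p - 1] at [1 / y]. A
    rational minorant makes the next inequalities polynomial. *)
Lemma powR_ge_quot p y : 1 < p <= 2 -> 0 < y ->
  0 < y + (p - 1) * (1 - y) /\ y ^+ 2 / (y + (p - 1) * (1 - y)) <= y `^ p.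
Proof.
move=> /andP[p1 p2] y0.
have q01 : 0 <= p - 1 <= 1 by rewrite subr_ge0 lerBlDr; lra.
have d0 : 0 < y + (p - 1) * (1 - y).
  have [y1|y1] := leP y 1; nra.
split=> //.
have iy0 : 0 < y^-1 by rewrite invr_gt0.
have := powR_le_tangent iy0 q01.
have -> : y^-1 `^ (p - 1) = (y `^ (p - 1))^-1.
  by rewrite -powR_inv1 ?(ltW y0)// -powRrM mulN1r powRN.
have yq : 0 < y `^ (p - 1) by rewrite powR_gt0.
have -> : 1 + (p - 1) * (y^-1 - 1) = (y + (p - 1) * (1 - y)) / y.
  by field; rewrite gt_eqF.
rewrite -(@mulr_powRB1 _ y p) ?(ltW y0)//; last by lra.
move=> H; rewrite ler_pdivrMr// expr2 -mulrA ler_wpM2l ?(ltW y0)//.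
rewrite ler_pdivlMr// in H.
rewrite -(ler_pM2l yq) mulrA mulfV ?gt_eqF// mul1r in H.
by [].
Qed.

Lemma powR_ge_tangent p y : 1 < p <= 2 -> 0 <= y -> 1 + p * (y - 1) <= y `^ p.
Proof.
move=> p12; rewrite le_eqVlt => /orP[/eqP <-|y0].
  by rewrite powR0; [lra|rewrite gt_eqF//; lra].
have [d0] := powR_ge_quot p12 y0; apply: le_trans.
rewrite ler_pdivlMr//.
have : 0 <= ((p - 1) * (1 - y)) ^+ 2 by rewrite sqr_ge0.
nra.
Qed.

(** With [d = 1 - y] and [q = p - 1], clearing the denominator of the rational minorant leaves
    [(q d)^2 (1 - (y + q d)) >= 0]. *)
Lemma powR_ge_tangent2 p y : 1 < p <= 2 -> 0 <= y <= 1 ->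
  1 + p * (y - 1) + (p - 1) ^+ 2 * (1 - y) ^+ 2 <= y `^ p.
Proof.
move=> p12 /andP[]; rewrite le_eqVlt => /orP[/eqP <- _|y0 y1].
  by rewrite powR0; [nra|rewrite gt_eqF//; lra].
have [d0] := powR_ge_quot p12 y0; apply: le_trans.
rewrite ler_pdivlMr//.
set d := 1 - y; set q := p - 1.
have d1 : 0 <= d by rewrite subr_ge0.
have q0 : 0 <= q by rewrite /q; lra.
have q1 : q <= 1 by rewrite /q; lra.
have -> : 1 + p * (y - 1) = y - q * d by rewrite /d /q; ring.
have -> : y = 1 - d by rewrite /d; ring.
have dd : d <= 1 by rewrite /d; lra.
have : 0 <= (q * d) ^+ 2 * (1 - (1 - d + q * d)).
  by rewrite mulr_ge0 ?sqr_ge0//; nra.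
lra.
Qed.

(** After division by the midpoint [c], the points [1 / c] and [x / c] are symmetric about 1, so the
    first-order terms cancel. The second-order term at [x / c] is the gain, as
    [1 - x / c >= (1 - x) / 2]. *)
Lemma midpoint_powR p x : 1 < p <= 2 -> 0 <= x <= 1 ->
  ((1 + x) / 2) `^ p * (1 + (p - 1) ^+ 2 * (1 - x) ^+ 2 / 8) <= (1 + x `^ p) / 2.
Proof.
move=> p12 /andP[x0 x1].
set c := (1 + x) / 2; have c0 : 0 < c by rewrite /c; lra.
have c1 : c <= 1 by rewrite /c; lra.
have cp : 0 < c `^ p by rewrite powR_gt0.
have y01 : 0 <= x / c <= 1.
  by rewrite divr_ge0 ?(ltW c0)//= ler_pdivrMr// mul1r /c; lra.
have T1 := powR_ge_tangent2 p12 y01.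
have T2 : 1 + p * (c^-1 - 1) <= c^-1 `^ p.
  by apply: powR_ge_tangent => //; rewrite invr_ge0 (ltW c0).
have E1 : x `^ p = c `^ p * (x / c) `^ p.
  have /andP[y0 _] := y01.
  by rewrite -(powRM _ (ltW c0) y0); congr (_ `^ _); field; rewrite gt_eqF.
have E2 : 1 = c `^ p * c^-1 `^ p.
  have y0 : 0 <= c^-1 by rewrite invr_ge0 ltW.
  by rewrite -(powRM _ (ltW c0) y0) mulfV ?gt_eqF// powR1.
have -> : (1 + x `^ p) / 2 = c `^ p * ((c^-1 `^ p + (x / c) `^ p) / 2).
  by rewrite mulrA mulrDr -E2 -E1.
rewrite ler_pM2l//.
have s2 : c^-1 + x / c = 2 by rewrite /c; field; rewrite gt_eqF//; lra.
have d1 : (1 - x) / 2 <= 1 - x / c.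
  rewrite lerBrDr -lerBrDl ler_pdivrMr// /c; nra.
have d2 : ((1 - x) / 2) ^+ 2 <= (1 - x / c) ^+ 2.
  by rewrite ler_sqr ?nnegrE//; lra.
have := ler_wpM2l (sqr_ge0 (p - 1)) d2.
have s3 : p * (x / c - 1) + p * (c^-1 - 1) = 0 by rewrite -mulrDr; nra.
lra.
Qed.

End UniformConvexity.

(** * Convexity gain for one block and for the whole norm *)

Section BlockNorms.
Context (R : realType).
Implicit Types (p : R) (a b v : nat -> R).

(* [gap] = 1/4096 is small enough that two lengths with ratio at least 1 - gap
   and a non-negligible difference already gain from the parallelogram law. *)
Definition gap : R := (16^-1) ^+ 3.

Lemma gapE : (16^-1) ^+ 2 = 16 * gap.
Proof. by rewrite /gap; field. Qed.

Lemma gap_gt0 : 0 < gap.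
Proof. by rewrite exprn_gt0// invr_gt0. Qed.

Lemma gap_le : gap <= 16^-1.
Proof. by have := gapE; have := gap_gt0; lra. Qed.

(** Twice this value is the relative gain of [midpoint_powR] at length ratio [1 - gap]. *)
Definition convexity_gain p : R := (p - 1) ^+ 2 * gap ^+ 2 / 16.

Lemma convexity_gain_bounds p : 1 < p <= 2 -> 0 < convexity_gain p <= gap.
Proof.
move=> /andP[p1 p2]; have g0 := gap_gt0; have g1 := gap_le.
rewrite /convexity_gain; apply/andP; split.
  by rewrite divr_gt0// mulr_gt0// exprn_gt0// subr_gt0.
have p1' : 0 <= p - 1 <= 1 by lra.
have h1 : (p - 1) ^+ 2 <= 1 by case/andP: p1' => *; rewrite expr_le1.
have h2 : (p - 1) ^+ 2 * gap ^+ 2 <= 1 * gap ^+ 2 by rewrite ler_wpM2r// sqr_ge0.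
nra.
Qed.

Lemma ge1_powR_le p x : 1 <= p -> 0 <= x <= 1 -> x `^ p <= x.
Proof.
move=> p1 /andP[]; rewrite le_eqVlt => /orP[/eqP <- _|x0 x1].
  by rewrite powR0// gt_eqF// (lt_le_trans ltr01).
by apply: ge1r_powR; rewrite ?x0.
Qed.

(** One block, scaled so that the longer vector has length 1: [x] is the length of the shorter one,
    [t] of the difference, [m] of the midpoint. Convexity of the power sees only lengths; if these
    nearly agree, the gain comes from the parallelogram law. If [t] is small there may be no gain,
    whence the error term on the right. *)
Lemma unit_block_ineq p x t m : 1 < p <= 2 -> 0 <= x <= 1 -> 0 <= t -> 0 <= m ->
  m ^+ 2 = (1 + x ^+ 2) / 2 - t ^+ 2 / 4 -> m <= (1 + x) / 2 ->
  m `^ p + convexity_gain p / 8 * t `^ p <=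
  (2^-1 + convexity_gain p / 8 / 16) * (1 + x `^ p).
Proof.
move=> p12 /andP[x0 x1] t0 m0 mE mx; have /andP[p1 p2] := p12.
have p0 : 0 <= p by lra.
have g0 := gap_gt0; have g1 := gap_le; have gE := gapE.
have /andP[] := convexity_gain_bounds p12.
set e := convexity_gain p => e0 e1.
set u := 1 + x `^ p.
have u1 : 1 <= u by rewrite lerDl powR_ge0.
have x01 : 0 <= x <= 1 by rewrite x0.
have mp : m `^ p <= ((1 + x) / 2) `^ p.
  by apply: ge0_ler_powR => //; rewrite nnegrE//; lra.
have mid := midpoint_powR p12 x01; rewrite -/u in mid.
have cp : 0 <= ((1 + x) / 2) `^ p by exact: powR_ge0.
have q0 : 0 <= (p - 1) ^+ 2 * (1 - x) ^+ 2 / 8.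
  by rewrite divr_ge0// mulr_ge0// sqr_ge0.
have mu : m `^ p <= u / 2 by nra.
(* A small difference is absorbed by the error term alone. *)
have [tu|tu] := leP (t `^ p) (u / 16).
  have := ler_wpM2l (ltW e0) tu; lra.
have t2 : t <= 2.
  have : t ^+ 2 <= 2 ^+ 2 by have := sqr_ge0 m; nra.
  by rewrite ler_sqr ?nnegrE.
have tp : t `^ p <= 4 * u.
  apply: (@le_trans _ _ (2 `^ p)).
    by apply: ge0_ler_powR => //; rewrite nnegrE.
  apply: (@le_trans _ _ (2 `^ 2%:R)); first by apply: ler_powR => //; lra.
  by rewrite powR_mulrn//; lra.
(* The term in [t] is at most [e / 2 * u], exactly what a factor [1 - e] on [u / 2] pays for. *)
suff mgain : m `^ p <= (1 - e) * (u / 2) by have := ler_wpM2l (ltW e0) tp; lra.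
(* Clearly different lengths: the scalar gain yields the factor [1 / (1 + 2 e)], which is at most
   [1 - e]. *)
have [xt|xt] := leP x (1 - gap).
  have : gap ^+ 2 <= (1 - x) ^+ 2 by rewrite ler_sqr ?nnegrE; lra.
  move=> /(ler_wpM2l (sqr_ge0 (p - 1))) H.
  have H2 : 2 * e <= (p - 1) ^+ 2 * (1 - x) ^+ 2 / 8 by rewrite /e /convexity_gain; lra.
  have H3 : ((1 + x) / 2) `^ p * (1 + 2 * e) <= u / 2.
    by apply: le_trans mid; rewrite ler_wpM2l// lerD2l.
  apply: (le_trans mp).
  have e2 : 0 <= 1 - e by lra.
  have := ler_wpM2l e2 H3.
  have : 0 <= ((1 + x) / 2) `^ p * (e * (1 - 2 * e)).
    by rewrite mulr_ge0// mulr_ge0//; lra.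
  lra.
(* Nearly equal lengths: now [t >= 1 / 16], so the parallelogram law gives [m^2 <= 1 - 4 gap], while
   [u / 2 >= 1 - gap]. *)
have m1 : m <= 1 by lra.
have t16 : 16^-1 <= t.
  rewrite leNgt; apply/negP => tl.
  have : t `^ p <= t by apply: ge1_powR_le; lra.
  lra.
have m2 : m <= 1 - 2 * gap.
  have : (16^-1 : R) ^+ 2 <= t ^+ 2 by rewrite ler_sqr ?nnegrE.
  have : x ^+ 2 <= 1 by rewrite expr_le1.
  move=> h1 h2; have gg := sqr_ge0 gap; have : m ^+ 2 <= (1 - 2 * gap) ^+ 2 by lra.
  by rewrite ler_sqr ?nnegrE//; lra.
have mm : m `^ p <= m by apply: ge1_powR_le; lra.
have xx : x ^+ 2 <= x `^ p.
  rewrite -powR_mulrn//; apply: ger_powR => //; lra.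
have uu : 1 - gap <= u / 2 by rewrite /u; nra.
have e2 : 0 <= 1 - e by lra.
have := ler_wpM2l e2 uu; have := mulr_ge0 (ltW e0) (ltW g0); lra.
Qed.

Lemma block_ineq p (A B D M : R) : 1 < p <= 2 ->
  0 <= A -> 0 <= B -> 0 <= D -> 0 <= M ->
  M ^+ 2 = (A ^+ 2 + B ^+ 2) / 2 - D ^+ 2 / 4 -> M <= (A + B) / 2 ->
  M `^ p + convexity_gain p / 8 * D `^ p <=
  (2^-1 + convexity_gain p / 8 / 16) * (A `^ p + B `^ p).
Proof.
move=> p12; wlog BA : A B / B <= A.
  move=> H A0 B0 D0 M0 ME MAB; have [BA|/ltW AB] := leP B A; first exact: H.
  by rewrite [A `^ p + _]addrC; apply: H => //; lra.
move=> A0 B0 D0 M0 ME MAB.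
have p0 : p != 0 by rewrite gt_eqF//; lra.
move: A0; rewrite le_eqVlt => /orP[/eqP A0|A0].
  have B00 : B = 0 by lra.
  have M00 : M = 0 by lra.
  have D00 : D = 0.
    move: ME; rewrite M00 -A0 B00 => ME; apply/eqP; rewrite -sqrf_eq0; apply/eqP; lra.
  by rewrite -A0 B00 M00 D00 powR0// mulr0 addr0 mulr0.
have A0' := ltW A0.
have scale X : 0 <= X -> X `^ p = A `^ p * (X / A) `^ p.
  by move=> X0; rewrite -powRM ?divr_ge0//; congr (_ `^ _); field; rewrite gt_eqF.
rewrite (scale M)// (scale D)// (scale B)//.
have Ap : 0 < A `^ p by rewrite powR_gt0.
have -> : A `^ p * (M / A) `^ p + convexity_gain p / 8 * (A `^ p * (D / A) `^ p) =
  A `^ p * ((M / A) `^ p + convexity_gain p / 8 * (D / A) `^ p) by ring.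
have -> : (2^-1 + convexity_gain p / 8 / 16) * (A `^ p + A `^ p * (B / A) `^ p) =
  A `^ p * ((2^-1 + convexity_gain p / 8 / 16) * (1 + (B / A) `^ p)) by ring.
rewrite ler_pM2l//; apply: unit_block_ineq => //.
- by rewrite divr_ge0//= ler_pdivrMr// mul1r.
- by rewrite divr_ge0.
- by rewrite divr_ge0.
- by rewrite expr_div_n ME; field; rewrite gt_eqF.
- by rewrite ler_pdivrMr//; have -> : (1 + B / A) / 2 * A = (A + B) / 2 by field; rewrite gt_eqF.
Qed.

Definition nrm2 (i j : nat) v : R := Num.sqrt (\sum_(i <= k < j) v k ^+ 2).

Lemma sum_sq_ge0 i j v : 0 <= \sum_(i <= k < j) v k ^+ 2.
Proof. by apply: sumr_ge0 => k _; rewrite sqr_ge0. Qed.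

Lemma nrm2_sq i j v : nrm2 i j v ^+ 2 = \sum_(i <= k < j) v k ^+ 2.
Proof. by rewrite sqr_sqrtr// sum_sq_ge0. Qed.

Lemma nrm2_parallelogram i j a b :
  nrm2 i j (fun k => (a k + b k) / 2) ^+ 2 =
  (nrm2 i j a ^+ 2 + nrm2 i j b ^+ 2) / 2 - nrm2 i j (fun k => a k - b k) ^+ 2 / 4.
Proof.
rewrite !nrm2_sq -big_split/= !mulr_suml -sumrB.
by apply: eq_bigr => k _; field.
Qed.

(** Lagrange's identity: the double sum of squares is twice the Cauchy-Schwarz defect. *)
Lemma nrm2_cauchy_schwarz i j a b :
  \sum_(i <= k < j) a k * b k <= nrm2 i j a * nrm2 i j b.
Proof.
set S := \sum_(i <= k < j) a k * b k.
have : 0 <= \sum_(i <= k < j) \sum_(i <= l < j) (a k * b l - a l * b k) ^+ 2.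
  by apply: sumr_ge0 => k _; apply: sumr_ge0 => l _; rewrite sqr_ge0.
have -> : \sum_(i <= k < j) \sum_(i <= l < j) (a k * b l - a l * b k) ^+ 2 =
    2 * (nrm2 i j a ^+ 2 * nrm2 i j b ^+ 2) - 2 * S ^+ 2.
  transitivity (\sum_(i <= k < j) \sum_(i <= l < j)
      (a k ^+ 2 * b l ^+ 2 + b k ^+ 2 * a l ^+ 2 - 2 * ((a k * b k) * (a l * b l)))).
    by apply: eq_bigr => k _; apply: eq_bigr => l _; ring.
  under eq_bigr => k _ do rewrite sumrB big_split/= -!mulr_sumr.
  rewrite sumrB big_split/= -!mulr_sumr -!mulr_suml !nrm2_sq -/S; ring.
move=> H; have [S0|S0] := leP S 0.
  by apply: (le_trans S0); rewrite mulr_ge0// sqrtr_ge0.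
rewrite -ler_sqr ?nnegrE ?(ltW S0) ?mulr_ge0 ?sqrtr_ge0// exprMn; lra.
Qed.

Lemma nrm2_midpoint i j a b :
  nrm2 i j (fun k => (a k + b k) / 2) <= (nrm2 i j a + nrm2 i j b) / 2.
Proof.
rewrite -ler_sqr ?nnegrE ?sqrtr_ge0//; last first.
  by rewrite divr_ge0// addr_ge0// sqrtr_ge0.
have CS := nrm2_cauchy_schwarz i j a b.
have -> : nrm2 i j (fun k => (a k + b k) / 2) ^+ 2 =
  (nrm2 i j a ^+ 2 + nrm2 i j b ^+ 2 + 2 * \sum_(i <= k < j) a k * b k) / 4.
  rewrite !nrm2_sq mulr_sumr -!big_split/= mulr_suml.
  by apply: eq_bigr => k _; field.
nra.
Qed.

(** The [p]-th power of the norm, which is additive over blocks. *)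
Definition pnrm p (ks : seq nat) v : R :=
  \sum_(j < (size ks).-1) nrm2 (nth 0%N ks j) (nth 0%N ks j.+1) v `^ p.

Lemma pnrm_ge0 p ks v : 0 <= pnrm p ks v.
Proof. by apply: sumr_ge0 => j _; exact: powR_ge0. Qed.

(** With [e = convexity_gain p], the errors of all blocks add up to at most [e / 64 * Q], and the
    separation hypothesis makes the gain at least [e / 32 * Q]. *)
Lemma pnrm_uniform_convexity p ks a b (Q : R) : 1 < p <= 2 ->
  pnrm p ks a <= Q -> pnrm p ks b <= Q -> Q <= 4 * pnrm p ks (fun k => a k - b k) ->
  pnrm p ks (fun k => (a k + b k) / 2) <= (1 - convexity_gain p / 64) * Q.
Proof.
move=> p12 aQ bQ dQ; have /andP[e0 _] := convexity_gain_bounds p12.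
have : pnrm p ks (fun k => (a k + b k) / 2) +
    convexity_gain p / 8 * pnrm p ks (fun k => a k - b k) <=
    (2^-1 + convexity_gain p / 8 / 16) * (pnrm p ks a + pnrm p ks b).
  rewrite /pnrm mulr_sumr -!big_split/= mulr_sumr; apply: ler_sum => j _.
  apply: block_ineq; rewrite ?sqrtr_ge0//; first exact: nrm2_parallelogram.
  exact: nrm2_midpoint.
move: (convexity_gain p) (pnrm p ks a) (pnrm p ks b) (pnrm p ks _) (pnrm p ks _)
  aQ bQ dQ e0 => e qa qb qd qm aQ bQ dQ e0.
have k0 : 0 <= 2^-1 + e / 8 / 16 by lra.
have := ler_wpM2l k0 (lerD aQ bQ); have := ler_wpM2l (ltW e0) dQ; lra.
Qed.

End BlockNorms.

(** * Lebesgue measure on tuples *)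

Section SigmaFiniteMeasure.
Context d (T : measurableType d) (R : realType) (mu : {measure set T -> \bar R}).

(** A copy of [mu] that carries the proof of sigma-finiteness, so that the structure can be attached
    to a measure obtained from an existence statement. *)
Definition sf_measure (sf : sigma_finite setT mu) : set T -> \bar R := mu.

Context (sf : sigma_finite setT mu).

HB.instance Definition _ := Measure.on (sf_measure sf).
HB.instance Definition _ := @Measure_isSigmaFinite.Build _ _ _ (sf_measure sf) sf.

End SigmaFiniteMeasure.

Section TupleMeasure.
Context (R : realType).
Local Open Scope ereal_scope.

Lemma eq_indic (T U : Type) (A : set T) (B : set U) x y : (A x <-> B y) ->
  \1_A x = \1_B y :> R.
Proof.
move=> AB; rewrite !indicE; have -> // : (x \in A) = (y \in B).
by apply/idP/idP; rewrite !inE => /AB.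
Qed.

Lemma le_indic (T : Type) (A B : set T) x : (A x -> B x) ->
  (\1_A x <= \1_B x :> R)%R.
Proof.
move=> AB; rewrite !indicE ler_nat; have [/set_mem Ax|//] := boolP (x \in A).
by rewrite mem_set//; exact: AB.
Qed.

(** The integral is a supremum over simple functions below the integrand, so it is monotone without
    measurability. This covers sections of a set [S] that is merely Lebesgue measurable. *)
Lemma ge0_integral_homo d (T : measurableType d) (mu : {measure set T -> \bar R})
    (f g : T -> \bar R) : (forall x, 0 <= f x) -> (forall x, f x <= g x) ->
  \int[mu]_x f x <= \int[mu]_x g x.
Proof.
move=> f0 fg; have g0 x : 0 <= g x := le_trans (f0 x) (fg x).
rewrite !ge0_integralTE//; apply: le_ereal_sup => _ [k kf <-].
by exists k => // x; exact: le_trans (kf x) (fg x).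
Qed.

Lemma iint_ge0 n (F : n.-tuple R -> \bar R) : (forall x, 0 <= F x) -> 0 <= iint F.
Proof.
elim: n F => [|n IH] F F0 /=; first exact: F0.
by apply: integral_ge0 => x _; exact: IH.
Qed.

Lemma iint_homo n (F G : n.-tuple R -> \bar R) :
  (forall x, 0 <= F x) -> (forall x, F x <= G x) -> iint F <= iint G.
Proof.
elim: n F G => [|n IH] F G F0 FG /=; first exact: FG.
by apply: ge0_integral_homo => x; [exact: iint_ge0|exact: IH].
Qed.

Lemma iint0 n : iint (fun _ : n.-tuple R => 0) = 0.
Proof. by elim: n => [//|n IH] /=; under eq_integral do rewrite IH; exact: integral0. Qed.

Definition cube n (M : R) : set (n.-tuple R) := [set x | forall i, (`|tnth x i| <= M)%R].

Lemma cube_cons n M (x : R) (t : n.-tuple R) :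
  @cube n.+1 M (cons_tuple x t) <-> (`|x| <= M)%R /\ @cube n M t.
Proof.
split=> [H|[xM tM] i].
  split=> [|i]; first by have := H ord0; rewrite tnth0.
  by have := H (lift ord0 i); rewrite tnthS.
by case: (unliftP ord0 i) => [j ->|->]; rewrite ?tnthS ?tnth0.
Qed.

Lemma vol_cube n M : (0 <= M)%R -> vol (@cube n M) = ((2 * M) ^+ n)%:E.
Proof.
move=> M0; elim: n => [|n IH].
  by rewrite /vol /= indicE mem_set// => -[].
rewrite /vol /=.
under eq_integral => x _.
  have -> : iint (fun t : n.-tuple R => (\1_(@cube n.+1 M) (cons_tuple x t))%:E) =
      (\1_`[- M, M] x)%:E * ((2 * M) ^+ n)%:E.
    rewrite indicE; have [xM|xM] := boolP (x \in `[(- M)%R, M]%classic).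
      rewrite mul1e -IH; congr iint; apply/funext => t; congr (_%:E).
      apply: eq_indic; split; first by move/cube_cons => -[].
      move=> tM; apply/cube_cons; split => //.
      by move: xM; rewrite inE/= in_itv/= ler_norml.
    rewrite mul0e -[RHS](iint0 n); congr iint; apply/funext => t; congr (_%:E).
    rewrite indicE memNset// => /cube_cons[xM' _]; move/negP : xM; apply.
    by rewrite inE/= in_itv/= -ler_norml.
  over.
rewrite ge0_integralZr//.
- rewrite exprS EFinM; congr (_ * _); rewrite integral_indic//= setIT.
  rewrite -[LHS]/(lebesgue_measure [set` `[(- M)%R, M]]) lebesgue_measure_itv/= lte_fin.
  have [MM|MM] := ltP (- M)%R M; first by rewrite -EFinB; congr (_%:E); ring.
  by congr (_%:E); lra.
- exact/measurable_EFinP.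
- by rewrite lee_fin exprn_ge0// mulr_ge0.
Qed.

Lemma measurable_cons_tuple n :
  measurable_fun setT (fun z : measurableTypeR R * n.-tuple R =>
    (cons_tuple (z.1 : R) z.2 : n.+1.-tuple R)).
Proof.
apply: (measurable_cons (f := fun z : measurableTypeR R * n.-tuple R => (z.1 : R))) => //.
exact: (@measurable_fst _ _ (measurableTypeR R) (n.-tuple R)).
Qed.

Lemma measurable_cube n M : measurable (@cube n M).
Proof.
have -> : @cube n M = \bigcap_(i : 'I_n) ((fun x => tnth x i) @^-1` `[(- M)%R, M]).
  apply/seteqP; split=> [x xM i _|x xM i].
    by rewrite /= in_itv/= -ler_norml.
  by have := xM i Logic.I; rewrite /= in_itv/= -ler_norml.
apply: fin_bigcap_measurable => // i _.
rewrite -[X in measurable X]setTI; exact: measurable_tnth.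
Qed.

Lemma sigma_finite_tuple_measure n (mu : {measure set (n.-tuple R) -> \bar R}) :
  (forall F : n.-tuple R -> \bar R, measurable_fun setT F -> (forall x, 0 <= F x) ->
    iint F = \int[mu]_x F x) ->
  sigma_finite setT mu.
Proof.
move=> muE; exists (fun k : nat => @cube n k%:R).
  apply/seteqP; split => // x _.
  exists (\sum_(i < n) (Num.truncn `|tnth x i|).+1)%N => // i /=.
  apply: (le_trans (ltW (truncnS_gt _))); rewrite ler_nat.
  by rewrite (bigD1 i)//= leq_addr.
move=> k; split; first exact: measurable_cube.
rewrite -[@cube n _]setIT -integral_indic//; last exact: measurable_cube.
have mc : measurable_fun setT (fun x => (\1_(@cube n k%:R) x)%:E : \bar R).
  by apply/measurable_EFinP; apply: measurable_indic; apply: measurable_cube.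
rewrite -(muE _ mc)//.
by rewrite [X in X < _](vol_cube n (ler0n R k)) ltry.
Qed.

(** Dimension 0 is a Dirac mass; the next dimension is the product with one-dimensional Lebesgue
    measure, pushed forward along [cons_tuple], and Tonelli gives the formula. The product needs
    sigma-finiteness, which the formula itself yields through cubes. *)
Lemma tuple_measure n : exists mu : {sigma_finite_measure set (n.-tuple R) -> \bar R},
  forall F : n.-tuple R -> \bar R, measurable_fun setT F -> (forall x, 0 <= F x) ->
  iint F = \int[mu]_x F x.
Proof.
suff [mu muE] : exists mu : {measure set (n.-tuple R) -> \bar R},
  forall F : n.-tuple R -> \bar R, measurable_fun setT F -> (forall x, 0 <= F x) ->
  iint F = \int[mu]_x F x.
  by exists (sf_measure (sigma_finite_tuple_measure muE)).
elim: n => [|n [mu0 muE0]].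
  exists (dirac ([tuple] : 0.-tuple R)) => F mF F0.
  by rewrite integral_dirac// diracT mul1e.
pose mu : {sigma_finite_measure set (n.-tuple R) -> \bar R} :=
  sf_measure (sigma_finite_tuple_measure muE0).
pose phi := fun z : measurableTypeR R * n.-tuple R =>
    (cons_tuple (z.1 : R) z.2 : n.+1.-tuple R).
have mphi : measurable_fun setT phi by exact: measurable_cons_tuple.
pose P := (@lebesgue_measure R \x mu).
exists (pushforward P phi) => F mF F0.
rewrite (ge0_integral_pushforward mphi)//=.
rewrite preimage_setT (fubini_tonelli1 (F \o phi)) /=.
- apply: eq_integral => x _; rewrite /fubini_F (muE0 (fun t => F (cons_tuple x t)))//.
  exact: (measurable_fun_pair2 (x : measurableTypeR R) (measurableT_comp mF mphi)).
- exact: measurableT_comp.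
- by move=> z; exact: F0.
Unshelve. exact: mphi.
Qed.

Lemma measurable_iint_cons n (F : n.+1.-tuple R -> \bar R) :
  measurable_fun setT F -> (forall x, 0 <= F x) ->
  measurable_fun setT (fun x : measurableTypeR R => iint (fun t => F (cons_tuple (x : R) t))).
Proof.
move=> mF F0; have [mu muE] := tuple_measure n.
have mG := measurableT_comp mF (@measurable_cons_tuple n).
have -> : (fun x : measurableTypeR R => iint (fun t => F (cons_tuple (x : R) t))) =
    (fun x => \int[mu]_t F (cons_tuple (x : R) t)).
  apply/funext => x; apply: muE => //.
  exact: (measurable_fun_pair2 (x : measurableTypeR R) mG).
exact: (measurable_fun_fubini_tonelli_F (m2 := mu) _ mG (fun=> F0 _)).
Qed.

(** The rescaled pushforward agrees with Lebesgue measure on half-open intervals, hence everywhere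
    by uniqueness. *)
Lemma lebesgue_integral_affine (a c : R) (F : R -> \bar R) : (0 < c)%R ->
  measurable_fun setT F -> (forall x, 0 <= F x) ->
  \int[lebesgue_measure]_x F ((x - a) / c)%R = c%:E * \int[lebesgue_measure]_x F x.
Proof.
move=> c0 mF F0.
pose phi (x : measurableTypeR R) : measurableTypeR R := ((x - a) / c)%R.
have mphi : measurable_fun setT phi.
  apply: (@measurable_funM _ (measurableTypeR R) R setT (fun x => x - a)%R (fun=> c^-1)%R) => //.
  apply: (@measurable_funB _ (measurableTypeR R) R setT (fun x => x)%R (fun=> a)%R) => //.
have c0' := ltW c0.
have ic0 : (0 <= c^-1)%R by rewrite invr_ge0.
pose nu := mscale (NngNum ic0) (pushforward (@lebesgue_measure R) phi).
have nuE A : measurable A -> lebesgue_measure A = nu mphi A.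
  apply: lebesgue_measure_unique => /= _ [[u v]] _ <-.
  rewrite /nu /mscale/= /pushforward.
  have -> : phi @^-1` `]u, v] = `](c * u + a)%R, (c * v + a)%R]%classic.
    apply/seteqP; split=> x /=; rewrite !in_itv/= /phi ltr_pdivlMr// ler_pdivrMr//.
      by move=> /andP[h1 h2]; apply/andP; split; lra.
    by move=> /andP[h1 h2]; apply/andP; split; lra.
  rewrite !lebesgue_measure_itv/= !lte_fin ltrD2r ltr_pM2l//.
  case: ifP => _; last by rewrite mule0.
  by rewrite -!EFinB -EFinM; congr (_%:E); field; rewrite gt_eqF.
have -> : \int[lebesgue_measure]_x F x = \int[nu mphi]_x F x.
  by apply: eq_measure_integral => A mA _; exact: nuE.
rewrite ge0_integral_mscale//= (ge0_integral_pushforward mphi)//= preimage_setT.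
by rewrite muleA -EFinM mulfV ?gt_eqF// mul1e.
Qed.

Definition affine n (a : n.-tuple R) (c : R) (x : n.-tuple R) : n.-tuple R :=
  [tuple ((tnth x i - tnth a i) / c)%R | i < n].

Lemma affine_cons n (a : n.+1.-tuple R) c (x : R) (t : n.-tuple R) :
  affine a c (cons_tuple x t) =
  cons_tuple ((x - thead a) / c)%R (affine [tuple of behead a] c t).
Proof.
apply: eq_from_tnth => i; rewrite tnth_mktuple.
case: (unliftP ord0 i) => [j ->|->]; last by rewrite !tnth0.
rewrite !tnthS tnth_mktuple tnth_behead.
have -> // : lift ord0 j = inord j.+1.
by apply/val_inj; rewrite /= inordK// ltnS.
Qed.

Lemma iint_affine n (a : n.-tuple R) (c : R) (F : n.-tuple R -> \bar R) : (0 < c)%R ->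
  measurable_fun setT F -> (forall x, 0 <= F x) ->
  iint (fun x => F (affine a c x)) = (c ^+ n)%:E * iint F.
Proof.
move=> c0; elim: n a F => [|n IH] a F mF F0.
  by rewrite /= expr0 mul1e (tuple0 (affine _ _ _)).
rewrite [LHS]/=; under eq_integral => x _.
  under eq_fun => t do rewrite affine_cons.
  rewrite (IH _ (fun t => F (cons_tuple ((x - thead a) / c)%R t)))//; last first.
    exact: (measurable_fun_pair2 (((x - thead a) / c)%R : measurableTypeR R)
      (measurableT_comp mF (@measurable_cons_tuple n))).
  over.
rewrite (@lebesgue_integral_affine (thead a) c
  (fun x => (c ^+ n)%:E * iint (fun t => F (cons_tuple x t))))//.
- rewrite ge0_integralZl ?lee_fin ?exprn_ge0 ?(ltW c0)//.
  + by rewrite muleA -EFinM -exprS.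
  + exact: measurable_iint_cons.
  + by move=> x _; exact: iint_ge0.
- by apply: measurable_funeM; exact: measurable_iint_cons.
- by move=> x; rewrite mule_ge0 ?lee_fin ?exprn_ge0 ?(ltW c0)//; exact: iint_ge0.
Qed.

End TupleMeasure.

(** * Superballs and lenses *)

Section SuperballDistance.
Context (R : realType) (p : R) (ks : seq nat) (n : nat).
Hypothesis p12 : 1 < p <= 2.
Implicit Types (x y a : n.-tuple R).

Let p0 : 0 < p. Proof. by case/andP: p12 => p1 _; lra. Qed.

Lemma nrm2Z i j (k : R) v : 0 <= k -> nrm2 i j (fun l => k * v l) = k * nrm2 i j v.
Proof.
move=> k0; rewrite /nrm2 -[X in X * Num.sqrt _](ger0_norm k0) -sqrtr_sqr.
rewrite -sqrtrM ?sqr_ge0// mulr_sumr; congr Num.sqrt.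
by apply: eq_bigr => l _; rewrite exprMn.
Qed.

Lemma pnrmZ (k : R) v : 0 <= k -> pnrm p ks (fun l => k * v l) = k `^ p * pnrm p ks v.
Proof.
move=> k0; rewrite /pnrm mulr_sumr; apply: eq_bigr => j _.
by rewrite nrm2Z// powRM// sqrtr_ge0.
Qed.

Definition diffv x y : nat -> R := fun i => nth 0 y i - nth 0 x i.

Lemma pkdistE x y : pkdist p ks x y = pnrm p ks (diffv x y) `^ p^-1.
Proof. by []. Qed.

Lemma pkdist_ge0 x y : 0 <= pkdist p ks x y.
Proof. exact: powR_ge0. Qed.

Lemma pkdistC x y : pkdist p ks x y = pkdist p ks y x.
Proof.
suff E : pnrm p ks (diffv x y) = pnrm p ks (diffv y x) by rewrite !pkdistE E.
apply: eq_bigr => j _; rewrite /nrm2.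
under eq_bigr => i _ do rewrite /diffv -sqrrN opprB.
by [].
Qed.

Lemma pkdist_powR x y : pkdist p ks x y `^ p = pnrm p ks (diffv x y).
Proof. by rewrite pkdistE -powRrM mulVf ?gt_eqF// powRr1// pnrm_ge0. Qed.

Lemma pkdist_le x y (s : R) : 0 <= s ->
  (pkdist p ks x y <= s) = (pnrm p ks (diffv x y) <= s `^ p).
Proof.
move=> s0; rewrite -pkdist_powR; apply/idP/idP => H.
  by apply: ge0_ler_powR; rewrite ?(ltW p0) ?nnegrE ?pkdist_ge0.
rewrite leNgt; apply/negP => K.
have := gt0_ltr_powR p0 _ _ K; rewrite !nnegrE s0 pkdist_ge0 => /(_ isT isT).
by rewrite ltNge H.
Qed.

Lemma nth_tuple_ord (x : n.-tuple R) (i : 'I_n) : nth 0 x i = tnth x i.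
Proof. by rewrite (tnth_nth 0). Qed.

Lemma diffv_affine a y (c : R) i :
  diffv (origin n) (affine a c y) i = c^-1 * diffv a y i.
Proof.
rewrite /diffv /origin /= nth_nseq if_same subr0.
have [ni|ni] := ltnP i n.
  rewrite (nth_mktuple _ 0 (Ordinal ni)) -!nth_tuple_ord mulrC//.
rewrite (nth_default _ (s := y)) ?size_tuple// (nth_default _ (s := a)) ?size_tuple//.
by rewrite subrr mulr0 nth_default// size_map -cardE card_ord.
Qed.

Lemma pkdist_affine a y (c : R) : 0 < c ->
  pkdist p ks (origin n) (affine a c y) = pkdist p ks a y / c.
Proof.
move=> c0; rewrite !pkdistE.
have -> : pnrm p ks (diffv (origin n) (affine a c y)) =
    pnrm p ks (fun i => c^-1 * diffv a y i).
  by congr pnrm; apply/funext => i; exact: diffv_affine.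
rewrite pnrmZ ?invr_ge0 ?(ltW c0)// powRM ?powR_ge0 ?pnrm_ge0//.
by rewrite -powRrM mulfV ?gt_eqF// powRr1 ?invr_ge0 ?(ltW c0)// mulrC.
Qed.

(** The block of [i] ends at the first entry of [ks] above [i], which is not the head because the
    head is 0. *)
Lemma block_of_index i : valid_k n ks -> (i < n)%N ->
  exists2 j, (j < (size ks).-1)%N & (nth 0 ks j <= i < nth 0 ks j.+1)%N.
Proof.
move=> [sz k0 kl _] ilt.
have hi : has (fun k => i < k)%N ks.
  apply/hasP; exists n => //; rewrite -kl.
  by case: (ks) sz => //= k l _; exact: mem_last.
have := nth_find 0%N hi; rewrite has_find in hi.
case E : (find (fun k => i < k)%N ks) => [|j]; first by rewrite k0.
move=> fj; exists j; first by rewrite -ltnS prednK -?E// (leq_ltn_trans _ sz).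
by rewrite fj andbT leqNgt; apply/negbT/before_find; rewrite E.
Qed.

Lemma coord_le_pkdist x y (i : 'I_n) : valid_k n ks ->
  `|tnth y i - tnth x i| <= pkdist p ks x y.
Proof.
move=> vk; have [j jk /andP[ki ik]] := block_of_index vk (ltn_ord i).
have E : `|tnth y i - tnth x i| <= nrm2 (nth 0%N ks j) (nth 0%N ks j.+1) (diffv x y).
  rewrite -sqrtr_sqr ler_wsqrtr// -!nth_tuple_ord -[X in X ^+ 2]/(diffv x y i).
  rewrite (bigD1_seq (val i)) ?iota_uniq ?mem_index_iota ?ki//=.
  by rewrite lerDl sumr_ge0// => l _; rewrite sqr_ge0.
have P0 := pkdist_ge0 x y.
apply: (le_trans E); rewrite leNgt; apply/negP => K.
have := gt0_ltr_powR p0 _ _ K; rewrite !nnegrE P0 sqrtr_ge0 => /(_ isT isT).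
rewrite ltNge pkdist_powR; move/negP; apply.
rewrite /pnrm (bigD1 (Ordinal jk))//= lerDl sumr_ge0// => l _; exact: powR_ge0.
Qed.

Lemma measurable_nth i : measurable_fun setT (fun x : n.-tuple R => nth 0 x i).
Proof.
have [ni|ni] := ltnP i n.
  have -> : (fun x : n.-tuple R => nth 0 x i) = (fun x => tnth x (Ordinal ni)).
    by apply/funext => x; rewrite (tnth_nth 0).
  exact: measurable_tnth.
have -> : (fun x : n.-tuple R => nth 0 x i) = (fun=> 0).
  by apply/funext => x; rewrite nth_default// size_tuple.
exact: measurable_cst.
Qed.

Lemma measurable_pkdist :
  measurable_fun setT (fun z : n.-tuple R * n.-tuple R => pkdist p ks z.1 z.2).
Proof.
have m1 i : measurable_fun setT (fun z : n.-tuple R * n.-tuple R => nth 0 z.1 i).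
  exact: (measurableT_comp (measurable_nth i) measurable_fst).
have m2 i : measurable_fun setT (fun z : n.-tuple R * n.-tuple R => nth 0 z.2 i).
  exact: (measurableT_comp (measurable_nth i) measurable_snd).
apply: (measurableT_comp (measurable_powR p^-1)).
apply: measurable_sum => j.
apply: (measurableT_comp (measurable_powR p)).
apply: (measurableT_comp (continuous_measurable_fun (@sqrt_continuous R))).
by apply: measurable_sum => i; apply: measurable_funX; exact: measurable_funB.
Qed.

Lemma measurable_pkdist_le x (s : R) : measurable (pkball p ks x s).
Proof.
rewrite -[pkball _ _ _ _]setTI.
have := measurable_fun_pair2 x measurable_pkdist.
move=> /(_ measurableT `]-oo, s]%classic (measurable_itv _)).
by congr measurable; apply/seteqP; split => y /=; rewrite in_itv.
Qed.

Lemma vol_homo (A B : set (n.-tuple R)) : A `<=` B -> (vol A <= vol B)%E.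
Proof.
by move=> AB; apply: iint_homo => x; rewrite lee_fin// le_indic//; exact: AB.
Qed.

Lemma vol_ge0 (A : set (n.-tuple R)) : (0 <= vol A)%E.
Proof. by apply: iint_ge0 => x; rewrite lee_fin. Qed.

Lemma vol_pkball_affine a (s c : R) : 0 < c ->
  vol (pkball p ks a s) = ((c ^+ n)%:E * vol (pkball p ks (origin n) (s / c)))%E.
Proof.
move=> c0; rewrite /vol -(@iint_affine _ _ a c)//; last first.
  by apply/measurable_EFinP; apply: measurable_indic; exact: measurable_pkdist_le.
congr iint; apply/funext => y; congr (_%:E); apply: eq_indic.
by rewrite /pkball /= pkdist_affine// ler_pM2r// invr_gt0.
Qed.

Hypotheses (vk : valid_k n ks) (n0 : (0 < n)%N).

Lemma vol_pkball_le_cube (s : R) : 0 <= s ->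
  (vol (pkball p ks (origin n) s) <= ((2 * s) ^+ n)%:E)%E.
Proof.
move=> s0; rewrite -vol_cube//; apply: vol_homo => y ys i.
apply: le_trans ys; have := coord_le_pkdist (origin n) y i vk.
by rewrite -(nth_tuple_ord (origin n)) /= nth_nseq if_same subr0.
Qed.

Lemma vol_pkball0 : vol (pkball p ks (origin n) 0) = 0%E.
Proof.
apply/eqP; rewrite eq_le vol_ge0 andbT.
by have := vol_pkball_le_cube (lexx 0); rewrite mulr0 expr0n gtn_eqF.
Qed.

Let E := [set r : R | (vol (pkball p ks (origin n) r) <= 1)%E].

Lemma rn_ge0 : 0 <= rn p ks n.
Proof.
(* Without [has_sup] the value of [sup] is 0 by convention. *)
have [sE|nE] := pselect (has_sup E); last by rewrite /rn sup_out.
by apply: sup_upper_bound => //; rewrite /E /= vol_pkball0 lee01.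
Qed.

(** For [theta > 1] some admissible radius exceeds [rn / theta], so that ball has volume at most 1.
    Scaling by [rho * theta] gives the bound [(rho * theta)^n], and [theta] is then brought close to
    1. *)
Lemma vol_pkball_rn a (rho : R) : 0 < rho ->
  (vol (pkball p ks a (rho * rn p ks n)) <= (rho ^+ n)%:E)%E.
Proof.
move=> r0; have := rn_ge0; rewrite le_eqVlt => /orP[/eqP <-|rn0].
  rewrite mulr0 (@vol_pkball_affine _ _ 1)// mul0r vol_pkball0 mule0.
  by rewrite lee_fin exprn_ge0// ltW.
have sE : has_sup E.
  by apply: contrapT => nE; move: rn0; rewrite /rn sup_out// ltxx.
have bound (theta : R) : 1 < theta ->
    (vol (pkball p ks a (rho * rn p ks n)) <= ((rho * theta) ^+ n)%:E)%E.
  move=> t1; have t0 : 0 < theta := lt_trans ltr01 t1.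
  rewrite (@vol_pkball_affine _ _ (rho * theta)) ?mulr_gt0//.
  rewrite -[leRHS]mule1 lee_wpmul2l ?lee_fin ?exprn_ge0 ?mulr_ge0 ?(ltW r0) ?(ltW t0)//.
  have -> : rho * rn p ks n / (rho * theta) = rn p ks n / theta.
    by field; rewrite !gt_eqF.
  have lt : rn p ks n / theta < rn p ks n by rewrite ltr_pdivrMr// ltr_pMr.
  have d0 : 0 < rn p ks n - rn p ks n / theta by rewrite subr_gt0.
  have [e Ee] := sup_adherent d0 sE.
  rewrite -/(rn p ks n) opprB addrC subrK => lte.
  apply: le_trans Ee; apply: vol_homo => y /= ys.
  exact: (le_trans ys (ltW lte)).
have rhon : 0 < rho ^+ n by rewrite exprn_gt0.
(* The value 2 serves to make the volume finite. *)
have := bound 2%:R; rewrite ltr1n => /(_ isT).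
have := vol_ge0 (pkball p ks a (rho * rn p ks n)).
move: bound; case: (vol _) => [v|//|//] bound v0 _.
rewrite lee_fin leNgt; apply/negP => rv.
pose w := v / rho ^+ n; have w1 : 1 < w by rewrite ltr_pdivlMr// mul1r.
have w0 : 0 < w := lt_trans ltr01 w1.
(* Here [theta^n] is the square root of [w], and the bound would read [w <= sqrt w] with [w > 1]. *)
pose theta := expR (ln w / (2 * n%:R)).
have nR : 0 < n%:R :> R by rewrite ltr0n.
have lnw : 0 < ln w by rewrite ln_gt0.
have t1 : 1 < theta by rewrite expR_gt1 divr_gt0// mulr_gt0.
have := bound _ t1; rewrite lee_fin exprMn.
have -> : theta ^+ n = expR (ln w / 2).
  by rewrite /theta -expRM_natl; congr expR; field; rewrite gt_eqF.
rewrite leNgt => /negP; apply.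
have -> : v = rho ^+ n * expR (ln w) by rewrite lnK// /w; field; rewrite gt_eqF.
by rewrite ltr_pM2l// ltr_expR; lra.
Qed.

(** The [p]-th root turns the gain for [pnrm] into one for distances; the theorem's constant is
    twice this value. *)
Definition contraction : R := (1 - convexity_gain p / 64) `^ p^-1.

Lemma contraction_base_gt0 : 0 < 1 - convexity_gain p / 64.
Proof. by have /andP[] := convexity_gain_bounds p12; have := gap_le R; lra. Qed.

Lemma contraction_bounds : 2^-1 <= contraction < 1.
Proof.
have /andP[e0 e1] := convexity_gain_bounds p12.
have g1 := gap_le R.
have ip : 0 < p^-1 by rewrite invr_gt0.
have b : 2^-1 <= 1 - convexity_gain p / 64 < 1 by apply/andP; split; lra.
case/andP: b => b1 b2; apply/andP; split.
  apply: (le_trans b1); apply: ger1_powR; first by rewrite (lt_le_trans _ b1)//= ltW.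
  by rewrite invf_le1//; case/andP: p12 => /ltW.
rewrite [ltRHS](_ : 1 = 1 `^ p^-1); last by rewrite powR1.
by apply: gt0_ltr_powR; rewrite ?nnegrE// (le_trans _ b1).
Qed.

Lemma le_contraction (r : R) : 0 <= r -> r <= 2 * contraction * r.
Proof.
move=> r0; have /andP[k0 _] := contraction_bounds.
by rewrite ler_peMl// -ler_pdivrMl// mulr1.
Qed.

(** If [v] is within [r] of [x], the ball of radius [r] about [x] suffices, as [contraction >= 1/2].
    Otherwise the centre is the midpoint of [x] and [v]: both [u - x] and [u - v] have norm at most
    [2 r], their difference has norm at least [r], and [(2 r)^p <= 4 r^p] since [p <= 2], so uniform
    convexity applies with [Q = (2 r)^p]. *)
Lemma ball_lens (x v : n.-tuple R) (r : R) : 0 <= r -> pkdist p ks x v <= 2 * r ->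
  exists a, forall u, pkdist p ks x u <= pkdist p ks x v ->
    pkdist p ks u v <= 2 * r -> pkdist p ks a u <= 2 * contraction * r.
Proof.
move=> r0 xv; have /andP[k0 k1] := contraction_bounds.
have /orP[vr|rv] := le_total (pkdist p ks x v) r.
  exists x => u xu _; apply: (le_trans xu); apply: (le_trans vr).
  exact: le_contraction.
exists [tuple ((tnth x i + tnth v i) / 2) | i < n] => u xu uv.
have r2 : 0 <= 2 * r by rewrite mulr_ge0.
have k0' : 0 <= contraction by rewrite (le_trans _ k0).
rewrite pkdist_le ?mulr_ge0//.
have -> : pnrm p ks (diffv [tuple (tnth x i + tnth v i) / 2 | i < n] u) =
    pnrm p ks (fun i => (diffv x u i + diffv v u i) / 2).
  congr pnrm; apply/funext => i; rewrite /diffv.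
  have [ni|ni] := ltnP i n.
    by rewrite (nth_mktuple _ 0 (Ordinal ni)) -!nth_tuple_ord/=; field.
  rewrite (nth_default _ (s := tval u)) ?size_tuple//.
  rewrite (nth_default _ (s := tval x)) ?size_tuple//.
  rewrite (nth_default _ (s := tval v)) ?size_tuple//.
  by rewrite nth_default ?size_tuple//; field.
have -> : (2 * contraction * r) `^ p = (1 - convexity_gain p / 64) * (2 * r) `^ p.
  have -> : 2 * contraction * r = contraction * (2 * r) by ring.
  rewrite powRM// /contraction -powRrM mulVf ?gt_eqF// powRr1//.
  exact: ltW contraction_base_gt0.
apply: pnrm_uniform_convexity.
- exact: p12.
- rewrite -(pkdist_le x u r2); exact: (le_trans xu xv).
- rewrite -(pkdist_le v u r2) (pkdistC v u); exact: uv.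
- have -> : (fun i => diffv x u i - diffv v u i) = diffv x v.
    by apply/funext => i; rewrite /diffv; ring.
  rewrite -(pkdist_powR x v) powRM//.
  apply: (@le_trans _ _ (4 * r `^ p)).
    rewrite ler_wpM2r ?powR_ge0//.
    have -> : 4 = 2 `^ 2%:R :> R by rewrite powR_mulrn//; ring.
    by apply: ler_powR; case/andP: p12 => //; rewrite ler1n.
  apply: ler_wpM2l => //; apply: (ge0_ler_powR (ltW p0)); last exact: rv.
    by rewrite nnegrE.
  by rewrite nnegrE; exact: pkdist_ge0.
Qed.

Lemma vol_lens (x v : n.-tuple R) : pkdist p ks x v <= 2 * rn p ks n ->
  (vol [set u | (pkdist p ks x u <= pkdist p ks x v)%R /\
    (pkdist p ks u v <= 2 * rn p ks n)%R] <= ((2 * contraction) ^+ n)%:E)%E.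
Proof.
move=> xv; have [a aP] := ball_lens rn_ge0 xv.
have /andP[k0 k1] := contraction_bounds.
apply: (@le_trans _ _ (vol (pkball p ks a (2 * contraction * rn p ks n)))).
  by apply: vol_homo => u [h1 h2]; exact: aP.
by apply: vol_pkball_rn; rewrite mulr_gt0// (lt_le_trans _ k0).
Qed.

End SuperballDistance.

(** * The hard-core model as a configuration integral *)

Section HardCoreIntegrals.
Context (R : realType) (n : nat).
Local Notation T := (n.-tuple R).
Context (mu : {sigma_finite_measure set T -> \bar R}).
Hypothesis muE : forall F : T -> \bar R, measurable_fun setT F ->
  (forall x, (0 <= F x)%E) -> iint F = (\int[mu]_x F x)%E.
Context (D : T -> T -> R) (s : R).
Hypothesis mD : measurable_fun setT (fun z : T * T => D z.1 z.2).
Hypothesis Dsym : forall x y, D x y = D y x.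
Local Open Scope ereal_scope.

Definition ind (A : set T) : T -> \bar R := fun x => (\1_A x)%:E.

Definition hard (x y : T) : \bar R :=
  (\1_[set z : T * T | (s <= D z.1 z.2)%R] (x, y))%:E.
Definition soft (x y : T) : \bar R :=
  (\1_[set z : T * T | (D z.1 z.2 < s)%R] (x, y))%:E.

Lemma measurable_ind A : measurable A -> measurable_fun setT (ind A).
Proof. by move=> mA; apply/measurable_EFinP; apply: measurable_indic. Qed.

Lemma ind_ge0 A x : 0 <= ind A x.
Proof. by rewrite lee_fin. Qed.

Lemma measurable_hard_set : measurable [set z : T * T | (s <= D z.1 z.2)%R].
Proof.
have := mD measurableT (measurable_itv `[s, +oo[).
by rewrite setTI; congr measurable; apply/seteqP; split => z /=; rewrite in_itv/= andbT.
Qed.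

Lemma measurable_soft_set : measurable [set z : T * T | (D z.1 z.2 < s)%R].
Proof.
have := mD measurableT (measurable_itv `]-oo, s[).
by rewrite setTI; congr measurable; apply/seteqP; split => z /=; rewrite in_itv/=.
Qed.

Lemma measurable_hard : measurable_fun setT (fun z : T * T => hard z.1 z.2).
Proof.
have -> : (fun z : T * T => hard z.1 z.2) =
    (fun z => (\1_[set z : T * T | (s <= D z.1 z.2)%R] z)%:E) by apply/funext => -[].
by apply/measurable_EFinP; apply: measurable_indic; exact: measurable_hard_set.
Qed.

Lemma measurable_soft : measurable_fun setT (fun z : T * T => soft z.1 z.2).
Proof.
have -> : (fun z : T * T => soft z.1 z.2) =
    (fun z => (\1_[set z : T * T | (D z.1 z.2 < s)%R] z)%:E) by apply/funext => -[].
by apply/measurable_EFinP; apply: measurable_indic; exact: measurable_soft_set.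
Qed.

Lemma hard_ge0 x y : 0 <= hard x y. Proof. by rewrite lee_fin. Qed.
Lemma soft_ge0 x y : 0 <= soft x y. Proof. by rewrite lee_fin. Qed.

Lemma hardC x y : hard x y = hard y x.
Proof. by congr (_%:E); apply: eq_indic; rewrite /= Dsym. Qed.

Lemma softC x y : soft x y = soft y x.
Proof. by congr (_%:E); apply: eq_indic; rewrite /= Dsym. Qed.

Lemma hard_soft x y : hard x y + soft x y = 1.
Proof.
rewrite /hard /soft !indicE -EFinD; have [sD|Ds] := leP s (D x y).
  by rewrite mem_set// memNset ?addr0//= ltNge sD.
by rewrite memNset ?mem_set ?add0r//= leNgt Ds.
Qed.

Definition config (S : set T) (xs : seq T) : Prop :=
  (forall i, (i < size xs)%N -> S (nth (nseq_tuple n (0%R : R)) xs i)) /\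
  (forall i j, (i < size xs)%N -> (j < size xs)%N -> i <> j ->
     (s <= D (nth (nseq_tuple n (0%R : R)) xs i) (nth (nseq_tuple n (0%R : R)) xs j))%R).

Lemma config_cons S x xs : config S (x :: xs) <->
  S x /\ config (S `&` [set y | (s <= D x y)%R]) xs.
Proof.
split=> [[H1 H2]|[Sx [H1 H2]]].
  split; first exact: (H1 0%N).
  split=> [i ixs|i j ixs jxs ij].
    by split; [exact: (H1 i.+1)|exact: (H2 0%N i.+1)].
  by apply: (H2 i.+1 j.+1) => // -[].
split=> [[|i] //= ixs|[|i] [|j] //= ixs jxs ij].
- exact: (H1 i ixs).1.
- exact: (H1 j jxs).2.
- by rewrite Dsym; exact: (H1 i ixs).2.
- by apply: H2 => // ji; apply: ij; rewrite ji.
Qed.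

Lemma cint0 t : cint t (fun _ : seq T => 0) = 0.
Proof. by elim: t => [//|t IH] /=; rewrite IH iint0. Qed.

Lemma cint_ge0 t (G : seq T -> \bar R) : (forall xs, 0 <= G xs) -> 0 <= cint t G.
Proof.
elim: t G => [|t IH] G G0 /=; first exact: G0.
by apply: iint_ge0 => x; exact: IH.
Qed.

Lemma cint_homo t (G H : seq T -> \bar R) : (forall xs, 0 <= G xs) ->
  (forall xs, G xs <= H xs) -> cint t G <= cint t H.
Proof.
elim: t G H => [|t IH] G H G0 GH /=; first exact: GH.
by apply: iint_homo => x; [exact: cint_ge0|exact: IH].
Qed.

Lemma link_ind S x :
  link hard (ind S) x = ind (S `&` [set y | (s <= D x y)%R]).
Proof.
apply/funext => y; rewrite /link /ind /hard indicI EFinM; congr (_ * _%:E).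
Qed.

Lemma measurable_hard_section x : measurable [set y | (s <= D x y)%R].
Proof.
have := measurable_fun_pair2 x mD; move=> /(_ measurableT _ (measurable_itv `[s, +oo[)).
by rewrite setTI; congr measurable; apply/seteqP; split => z /=; rewrite in_itv/= andbT.
Qed.

Lemma cint_config t S : measurable S ->
  cint t (fun xs => (\1_(config S) xs)%:E) = hs mu hard t (ind S).
Proof.
elim: t S => [|t IH] S mS /=.
  by rewrite indicE mem_set.
have mf := measurable_ind mS; have f0 := ind_ge0 S.
rewrite -muE; last 2 first.
- apply: emeasurable_funM => //.
  apply: ((mfunctional_hs mu measurable_hard hard_ge0 t).2 _ T
    (fun z => link hard (ind S) z.1 z.2)).
    exact: measurable_link measurable_hard _ mf.
  by move=> w; apply: link_ge0 => //; exact: hard_ge0.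
- move=> x; rewrite mule_ge0//.
  apply: (mfunctional_hs mu measurable_hard hard_ge0 t).1.
  by apply: link_ge0 => //; exact: hard_ge0.
congr iint; apply/funext => x; rewrite link_ind -IH; last first.
  by apply: measurableI => //; exact: measurable_hard_section.
rewrite {1}/ind indicE; have [xS|xS] := boolP (x \in S).
  rewrite mul1e; congr cint; apply/funext => xs; congr (_%:E); apply: eq_indic.
  by rewrite config_cons; split=> [[]//|]; split => //; exact: set_mem.
rewrite mul0e -[RHS](cint0 t); congr cint; apply/funext => xs; congr (_%:E).
rewrite indicE memNset// => /config_cons[Sx _].
by move/negP : xS; apply; rewrite inE.
Qed.

Lemma cint_config_mono t (S S' : set T) : S `<=` S' ->
  cint t (fun xs => (\1_(config S) xs)%:E) <= cint t (fun xs => (\1_(config S') xs)%:E).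
Proof.
move=> SS; apply: cint_homo => xs; first by rewrite lee_fin.
by rewrite lee_fin le_indic// => -[H1 H2]; split => // i ixs; apply/SS/H1.
Qed.

(** Monotonicity in the set squeezes the integral for [S] between those for [A] and [B], which
    coincide because the indicators agree almost everywhere. *)
Lemma cint_config_sandwich t (A S B : set T) : measurable A -> measurable B ->
  A `<=` S -> S `<=` B -> mu (B `\` A) = 0 ->
  cint t (fun xs => (\1_(config S) xs)%:E) = hs mu hard t (ind A).
Proof.
move=> mA mB AS SB BA0; apply/eqP; rewrite eq_le; apply/andP; split.
  apply: (le_trans (cint_config_mono t SB)); rewrite cint_config//.
  rewrite (@hs_ae _ _ _ mu hard measurable_hard hard_ge0 t (ind B) (ind A))//.
  - exact: measurable_ind.
  - by move=> x; exact: ind_ge0.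
  - exact: measurable_ind.
  - by move=> x; exact: ind_ge0.
  - exists (B `\` A); split => //; first exact: measurableD.
    move=> x /=; rewrite /ind; apply: contra_notP => xBA; congr (_%:E).
    apply: eq_indic; split => [Bx|/AS/SB//].
    by apply: contrapT => nAx; apply: xBA.
by rewrite -cint_config//; exact: cint_config_mono.
Qed.

Lemma integral_ind A : measurable A -> \int[mu]_x ind A x = mu A.
Proof. by move=> mA; rewrite integral_indic// setIT. Qed.

Lemma measurable_section_set (U : set (T * T)) x : measurable U ->
  measurable [set y | U (x, y)].
Proof. by move=> mU; have := measurable_xsection x mU; rewrite xsectionE. Qed.

Lemma measurable_soft_section x : measurable [set y | (D x y < s)%R].
Proof. exact: (measurable_section_set x measurable_soft_set). Qed.

Lemma softE x y : soft x y = ind [set y | (D x y < s)%R] y.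
Proof. by congr (_%:E); exact: eq_indic. Qed.

Definition lens (x v : T) : set T := [set u | (D x u <= D x v)%R /\ (D u v <= s)%R].

Lemma measurable_lens x v : measurable (lens x v).
Proof.
have m1 := measurable_fun_pair2 x mD.
have m2 := measurable_fun_pair1 v mD.
have := m1 measurableT _ (measurable_itv `]-oo, D x v]).
have := m2 measurableT _ (measurable_itv `]-oo, s]).
rewrite !setTI => h1' h2'; have := measurableI _ _ h2' h1'.
by congr measurable; apply/seteqP; split => z /=; rewrite !in_itv/=.
Qed.

(* Ordering the pair (u, y) by distance from x loses a factor 2, and then u
   ranges over a lens. *)
Lemma local_sparsity (C : R) x b : (0 <= C)%R ->
  (forall v, (D x v < s)%R -> mu (lens x v) <= C%:E) ->
  measurable_fun setT b -> (forall y, 0 <= b y <= soft x y) ->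
  \int[mu]_u (b u * \int[mu]_y clink soft b u y) <= (2 * C)%:E * \int[mu]_y b y.
Proof.
move=> C0 hC mb bs.
have b0 y : 0 <= b y by case/andP: (bs y).
have mc : measurable_fun setT (fun z : T * T => clink soft b z.1 z.2).
  exact: measurable_clink measurable_soft _ mb.
have c0 u y : 0 <= clink soft b u y by apply: clink_ge0 => //; exact: soft_ge0.
pose closer := [set z : T * T | (D x z.1 <= D x z.2)%R].
have m1 := measurable_fun_pair2 x mD.
have mcl : measurable closer.
  have mm : measurable_fun setT (fun z : T * T => D x z.2 - D x z.1)%R.
    apply: measurable_funB.
      exact: (measurableT_comp m1 measurable_snd).
    exact: (measurableT_comp m1 measurable_fst).
  have := mm measurableT _ (measurable_itv `[0%R, +oo[).
  rewrite setTI; congr measurable; apply/seteqP; split => z /=;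
  by rewrite in_itv/= andbT subr_ge0.
pose G (z : T * T) := b z.1 * clink soft b z.1 z.2 * (\1_closer z)%:E.
have mcl' : measurable_fun setT (fun z : T * T => (\1_closer z)%:E : \bar R).
  by apply/measurable_EFinP; apply: measurable_indic.
have G0 z : 0 <= G z by rewrite !mule_ge0// lee_fin.
have mG : measurable_fun setT G.
  apply: emeasurable_funM => //; apply: emeasurable_funM => //.
  exact: (measurableT_comp mb measurable_fst).
have mGs : measurable_fun setT (fun z : T * T => G (z.2, z.1)).
  exact: (measurableT_comp mG (@measurable_swap _ _ T T)).
have half : \int[mu]_u \int[mu]_y G (u, y) <= C%:E * \int[mu]_y b y.
  rewrite fubini_tonelli// -ge0_integralZl//.
  apply: ge0_le_integral => //.
  - by move=> y _; apply: integral_ge0.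
  - exact: (measurable_fun_fubini_tonelli_G (m1 := mu) _ mG G0).
  - exact: measurable_funeM.
  (* Where [b y] is nonzero, [b <= soft x] puts [y] within [s] of [x], where the lens bound is
     available. *)
  move=> y _; have [by0|by0] := eqVneq (b y) 0.
    rewrite by0 mule0 integral0_eq// => u _.
    by rewrite /G /= /clink by0 mul0e mule0 mul0e.
  have Dxy : (D x y < s)%R.
    rewrite ltNge; apply/negP => sD; move: by0.
    have := bs y; rewrite softE /ind indicE memNset/=; last by rewrite ltNge sD.
    by move/le_anti => ->; rewrite eqxx.
  rewrite [leRHS]muleC.
  apply: (@le_trans _ _ (b y * mu (lens x y))); last by rewrite lee_wpmul2l// hC.
  rewrite -integral_ind; last exact: measurable_lens.
  have ml : measurable_fun setT (ind (lens x y)).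
    by apply: measurable_ind; exact: measurable_lens.
  rewrite -ge0_integralZl//; last by move=> u _; exact: ind_ge0.
  apply: ge0_le_integral => //.
  - exact: (measurable_fun_pair1 y mG).
  - exact: measurable_funeM.
  move=> u _; rewrite /G /= /clink.
  have bu1 : b u <= 1.
    case/andP: (bs u) => _ /le_trans; apply.
    by rewrite -(hard_soft x u) leeDr// hard_ge0.
  have [ux|nux] := pselect (lens x y u).
    rewrite [ind _ _]/ind [X in _ <= _ * X%:E]indicE mem_set// mule1.
    apply: (@le_trans _ _ (b u * (b y * soft u y))).
      rewrite -[leRHS]mule1 lee_wpmul2l ?mule_ge0 ?soft_ge0//.
      by rewrite lee_fin indicE lern1 leq_b1.
    apply: (@le_trans _ _ (b u * b y)).
      rewrite lee_wpmul2l// -[leRHS]mule1 lee_wpmul2l//.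
      by rewrite -(hard_soft u y) leeDr// hard_ge0.
    by rewrite -[leRHS]mul1e lee_wpmul2r.
  suff -> : b u * (b y * soft u y) * (\1_closer (u, y))%:E = 0.
    by rewrite mule_ge0// ind_ge0.
  have [xuy|xuy] := leP (D x u) (D x y); last first.
    by rewrite [X in _ * X%:E]indicE memNset ?mule0// /closer /= leNgt xuy.
  have uy : ~ (D u y < s)%R by move=> /ltW uy; apply: nux.
  by rewrite softE [ind _ _]/ind [X in b y * X%:E]indicE memNset// !(mule0, mul0e).
pose H (z : T * T) := G z + G (z.2, z.1).
apply: (@le_trans _ _ (\int[mu]_u \int[mu]_y H (u, y))).
  have mbc : measurable_fun setT (fun z : T * T => b z.1 * clink soft b z.1 z.2).
    by apply: emeasurable_funM => //; exact: (measurableT_comp mb measurable_fst).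
  have -> : \int[mu]_u (b u * \int[mu]_y clink soft b u y) =
      \int[mu]_u \int[mu]_y (b u * clink soft b u y).
    apply: eq_integral => u _; rewrite -ge0_integralZl//.
    exact: (measurable_clink1 measurable_soft u mb).
  apply: ge0_integral_homo => [u|u].
    by apply: integral_ge0 => y _; rewrite mule_ge0.
  apply: ge0_integral_homo => [y|y]; first by rewrite mule_ge0.
  rewrite /H /G /=; have [uy|/ltW yu] := leP (D x u) (D x y).
    by rewrite [X in _ * X%:E + _]indicE mem_set//= mule1 leeDl// !mule_ge0// lee_fin.
  rewrite [X in _ + _ * X%:E]indicE mem_set//= mule1.
  have -> : b u * clink soft b u y = b y * clink soft b y u.
    by rewrite /clink softC muleCA.
  by rewrite leeDr// !mule_ge0// lee_fin.
have -> : \int[mu]_u \int[mu]_y H (u, y) =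
    \int[mu]_u \int[mu]_y G (u, y) + \int[mu]_u \int[mu]_y G (y, u).
  rewrite -ge0_integralD//.
  - apply: eq_integral => u _; rewrite -ge0_integralD//.
      exact: (measurable_fun_pair2 u mG).
    exact: (measurable_fun_pair2 u mGs).
  - by move=> u _; apply: integral_ge0.
  - exact: (measurable_fun_fubini_tonelli_F (m2 := mu) _ mG G0).
  - by move=> u _; apply: integral_ge0.
  - exact: (measurable_fun_fubini_tonelli_F (m2 := mu) _ mGs (fun=> G0 _)).
rewrite [X in _ + X](fubini_tonelli (fun z => G (z.2, z.1)))// -mule2n -mule_natl.
by rewrite EFinM -muleA lee_wpmul2l.
Qed.

Lemma density_ind_ineq (lam K C W V : R) A : (0 < lam)%R -> (0 <= K)%R -> (0 <= C)%R ->
  (lam * (2 * C) <= 1)%R -> (1 <= W)%R ->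
  measurable A -> (0 < V)%R -> mu A = V%:E ->
  (forall x, mu [set y | (D x y < s)%R] <= K%:E) ->
  (forall x v, (D x v < s)%R -> mu (lens x v) <= C%:E) ->
  ((1 - lam * (2 * C)) * (1 + ln W) <=
    (K + (1 - lam * (2 * C)) * (W / lam)) * density mu hard lam (ind A))%R.
Proof.
move=> l0 K0 C0 lC W1 mA V0 AV hK hC.
have cl_le x y : clink soft (ind A) x y <= soft x y.
  rewrite -[leRHS]mul1e lee_wpmul2r ?soft_ge0//.
  by rewrite lee_fin indicE lern1 leq_b1.
apply: (@density_ineq _ _ _ mu hard measurable_hard hard_ge0 hardC soft
  measurable_soft soft_ge0 softC hard_soft lam K (2 * C) V) => //.
- by rewrite mulr_ge0.
- exact: measurable_ind.
- by move=> x; exact: ind_ge0.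
- by rewrite integral_ind.
- move=> x; apply: (le_trans _ (hK x)).
  rewrite -integral_ind; last exact: measurable_soft_section.
  apply: ge0_integral_homo => y; last by rewrite -softE cl_le.
  by rewrite mule_ge0 ?soft_ge0// ind_ge0.
- move=> x b mb bb; apply: (local_sparsity C0 (hC x) mb) => y.
  by case/andP: (bb y) => -> /le_trans ->.
Qed.

End HardCoreIntegrals.

(** * The density bound *)

Section ErrorTerm.
Context (R : realType).

(** At [lam = 1 / (n c^n)] the factor [1 - 2 lam c^n] equals [1 - 2 / n], and [ln W] will be at
    least [n L - 2 ln n - ln L]; the formula multiplies these two relative losses. For [n < 3] the
    first factor is not positive, and the value -1 reduces the claim to nonnegativity. The minimum
    with 0 gives [ln (1 + density_err L n)] a favourable sign. *)
Definition density_err (L : R) (n : nat) : R :=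
  if (n < 3)%N then -1 else
  Num.min 0 ((1 - 2 / n%:R) * (1 - (2 * ln n%:R + ln L) / (n%:R * L)) - 1).

(** A rate of order [1 / sqrt n] is enough, and it follows from
    [ln n = 2 ln (sqrt n) <= 2 sqrt n]. *)
Lemma density_err_bound (L : R) n : 0 < L -> (2 < n)%N ->
  `|density_err L n| <= (2 + (4 + `|ln L|) / L) / Num.sqrt n%:R.
Proof.
move=> L0 n3; rewrite /density_err ltnNge n3 /=.
have n1 : 1 <= n%:R :> R by rewrite ler1n (leq_trans _ n3).
have n0 : 0 < n%:R :> R := lt_le_trans ltr01 n1.
set q := Num.sqrt n%:R; have q0 : 0 < q by rewrite sqrtr_gt0.
have qE : n%:R = q ^+ 2 by rewrite sqr_sqrtr// ltW.
have q1 : 1 <= q by rewrite -(ler_pXn2r (n := 2)) ?nnegrE ?(ltW q0)// expr1n -qE.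
have lnn : ln n%:R = 2 * ln q by rewrite qE lnXn// mulr_natl.
have lq0 : 0 <= ln q by rewrite ln_ge0.
have lq := ltW (ln_sublinear q0).
set l := `|ln L|; have l0 : 0 <= l by rewrite /l normr_ge0.
have lL : `|2 * ln n%:R + ln L| <= 4 * q + l.
  rewrite (le_trans (ler_normD _ _))// lerD2r lnn ger0_norm ?mulr_ge0//.
  lra.
set b := (2 * ln n%:R + ln L) / (n%:R * L).
have bB : `|b| <= (4 + l) / L / q.
  rewrite /b normrM normfV (ger0_norm (ltW (mulr_gt0 n0 L0))) qE.
  rewrite ler_pdivrMr ?mulr_gt0 ?exprn_gt0//.
  have -> : (4 + l) / L / q * (q ^+ 2 * L) = (4 + l) * q by field; rewrite !gt_eqF.
  rewrite -qE; apply: (le_trans lL); have : l <= l * q by rewrite ler_peMr.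
  lra.
have aB : 2 / n%:R <= 2 / q.
  by rewrite ler_pM2l// lef_pV2 ?posrE// qE expr2 ler_peMl// ltW.
have a0 : 0 <= 2 / n%:R :> R by rewrite divr_ge0// ltW.
have a1 : 2 / n%:R <= 1 :> R by rewrite ler_pdivrMr// mul1r ler_nat ltnW.
set a := 2 / n%:R in a0 a1 aB *.
have -> : (2 + (4 + l) / L) / q = 2 / q + (4 + l) / L / q by rewrite mulrDl.
have b1 : b <= `|b| by exact: ler_norm.
have bb0 : 0 <= `|b| := normr_ge0 b.
have key : - (a + `|b|) <= (1 - a) * (1 - b) - 1 by nra.
have : `|Num.min 0 ((1 - a) * (1 - b) - 1)| <= a + `|b|.
  have [h|h] := leP 0 ((1 - a) * (1 - b) - 1); first by rewrite normr0; lra.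
  by rewrite ltr0_norm//; lra.
by move/le_trans; apply; lra.
Qed.

Lemma density_err_cvg (L : R) : 0 < L -> density_err L @ \oo --> 0.
Proof.
move=> L0; apply/cvgrPdist_le => e e0.
set K := 2 + (4 + `|ln L|) / L.
have K0 : 0 < K by rewrite /K addr_gt0// divr_gt0// ltr_wpDr.
exists (maxn 3 (Num.truncn ((K / e) ^+ 2)).+1) => // n /=.
rewrite geq_max => /andP[n3 nK]; rewrite sub0r normrN.
apply: (le_trans (density_err_bound L0 n3)); rewrite -/K.
have n0 : 0 < n%:R :> R by rewrite ltr0n (leq_trans _ n3).
rewrite ler_pdivrMr ?sqrtr_gt0// mulrC -ler_pdivrMr//.
rewrite -(ler_pXn2r (n := 2)) ?nnegrE ?sqrtr_ge0 ?divr_ge0 ?(ltW K0) ?(ltW e0)//.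
rewrite sqr_sqrtr ?(ltW n0)//; apply: le_trans (ltW (truncnS_gt _)) _.
by rewrite ler_nat.
Qed.

(** By contradiction, with [t] the factor [1 + density_err L n] and [e = 1 - 2 / n]: if
    [2^n a < t n L], the right side of the hypothesis at a suitable [W] is below [t n L + e], while
    the left side is at least [e + e Y >= e + t n L]. *)
Lemma density_lower_bound (L c a : R) n : 0 < c -> L = ln (2 / c) -> 0 < L ->
  (2 < n)%N -> 0 <= a ->
  (forall W, 1 <= W -> (1 - 2 / n%:R) * (1 + ln W) <=
     (2 ^+ n + (1 - 2 / n%:R) * (W / (n%:R^-1 * (c ^+ n)^-1))) * a) ->
  (1 + density_err L n) * (L * n%:R / 2 ^+ n) <= a.
Proof.
move=> c0 LE L0 n3 a0 H.
have n0 : 0 < n%:R :> R by rewrite ltr0n (leq_trans _ n3).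
have p2 : 0 < 2 ^+ n :> R by rewrite exprn_gt0.
have cn : 0 < c ^+ n by rewrite exprn_gt0.
have [e0|e0] := leP (1 + density_err L n) 0.
  apply: le_trans a0; rewrite mulr_le0_ge0// divr_ge0 ?mulr_ge0 ?(ltW L0) ?(ltW n0)//.
set t := 1 + density_err L n in e0 *.
have t1 : t <= 1 by rewrite /t /density_err ltnNge n3 /= gerDl ge_min lexx.
pose e := 1 - 2 / n%:R : R.
have eg : 0 < e by rewrite subr_gt0 ltr_pdivrMr// mul1r ltr_nat.
pose Y := n%:R * L - 2 * ln n%:R - ln L.
have tY : t * (n%:R * L) <= e * Y.
  have nL : 0 < n%:R * L by rewrite mulr_gt0.
  have : t <= e * (1 - (2 * ln n%:R + ln L) / (n%:R * L)).
    rewrite /t /density_err ltnNge n3 /=.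
    by rewrite -lerBrDl ge_min lexx orbT.
  move=> /(ler_wpM2r (ltW nL)) /le_trans; apply.
  rewrite -mulrA ler_pM2l// mulrBl mul1r divfK ?gt_eqF// /Y; lra.
have Y0 : 0 < Y.
  rewrite -(pmulr_rgt0 _ eg); apply: lt_le_trans tY.
  by rewrite mulr_gt0// mulr_gt0.
rewrite leNgt; apply/negP => aL.
pose l0 := n%:R^-1 * (c ^+ n)^-1 : R.
have l00 : 0 < l0 by rewrite mulr_gt0// invr_gt0.
have t0 : 0 < t * (n%:R * L) by rewrite mulr_gt0// mulr_gt0.
(* Chosen so that [W / l0] is the reciprocal of the density being refuted; the term with [W] then
   contributes less than [e]. *)
pose W := l0 * 2 ^+ n / (t * (n%:R * L)).
have W0 : 0 < W by rewrite divr_gt0// mulr_gt0.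
have lnt : ln t <= 0 by rewrite ln_le0.
have lnW : Y <= ln W.
  have -> : W = (2 / c) ^+ n / (n%:R * (t * (n%:R * L))).
    by rewrite /W /l0 expr_div_n; field; rewrite !gt_eqF.
  have c2 : 0 < 2 / c by rewrite divr_gt0.
  rewrite ln_div ?posrE ?mulr_gt0 ?exprn_gt0//.
  rewrite lnXn// -LE -[L *+ n]mulr_natl !lnM ?posrE ?mulr_gt0//.
  rewrite /Y; lra.
have W1 : 1 <= W.
  rewrite leNgt; apply/negP => W1.
  have : ln W < 0 by rewrite ln_lt0// W0.
  lra.
have := H W W1; rewrite -/l0 -/e.
have -> : (2 ^+ n + e * (W / l0)) * a = 2 ^+ n * a * (1 + e / (t * (n%:R * L))).
  by rewrite /W; field; rewrite !gt_eqF.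
have aL' : 2 ^+ n * a < t * (n%:R * L).
  have -> : t * (n%:R * L) = 2 ^+ n * (t * (L * n%:R / 2 ^+ n)).
    by field; rewrite gt_eqF.
  by rewrite ltr_pM2l.
have u0 : 0 < 1 + e / (t * (n%:R * L)) by rewrite addr_gt0// divr_gt0.
have := aL'; rewrite -(ltr_pM2r u0) mulrDr mulr1 => H1 H2.
have := le_lt_trans H2 H1.
have -> : t * (n%:R * L) * (1 + e / (t * (n%:R * L))) = t * (n%:R * L) + e.
  by field; rewrite !gt_eqF.
have := ler_wpM2l (ltW eg) lnW.
lra.
Qed.

End ErrorTerm.

(** * Identification of [alpha] with the weighted density, and conclusion *)

Section Assembly.
Context (R : realType) (p : R) (ks : seq nat) (n : nat).
Local Notation T := (n.-tuple R).
Context (mu : {sigma_finite_measure set T -> \bar R}).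
Hypothesis muE : forall F : T -> \bar R, measurable_fun setT F ->
  (forall x, (0 <= F x)%E) -> iint F = (\int[mu]_x F x)%E.
Local Notation D := (@pkdist R p ks n).
Local Notation s := (2 * rn p ks n).
Local Notation hardD := (hard D s).

Let mD := @measurable_pkdist R p ks n.

Lemma vol_mu (A : set T) : measurable A -> vol A = mu A.
Proof.
move=> mA; rewrite -integral_ind// -muE//; first exact: measurable_ind.
by move=> x; exact: ind_ge0.
Qed.

Section Sandwich.
Context (A S B : set T).
Hypotheses (mA : measurable A) (mB : measurable B) (AS : A `<=` S) (SB : S `<=` B).
Hypothesis BA0 : mu (B `\` A) = 0%E.

Lemma vol_sandwich : vol S = mu A.
Proof.
apply/eqP; rewrite eq_le; apply/andP; split.
  apply: (le_trans (vol_homo SB)); rewrite vol_mu//.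
  rewrite -(setDUK (subset_trans AS SB)).
  by apply: (le_trans (measureU2 _ _ _)) => //; [exact: measurableD|rewrite [X in (_ + X)%E]BA0 adde0].
by rewrite -vol_mu//; exact: vol_homo.
Qed.

Lemma Zhat_sandwich t : Zhat p ks S t = zc mu hardD t (ind A).
Proof.
rewrite /Zhat /zc; congr (_ * _)%E.
exact: (cint_config_sandwich muE s mD (@pkdistC R p ks n) t mA mB AS SB BA0).
Qed.

Lemma alpha_density lam : alpha p ks S lam = density mu hardD lam (ind A).
Proof.
rewrite /alpha /expected_size /density integral_ind// vol_sandwich.
have -> : Zmom p ks S lam = mom mu hardD lam (ind A).
  by apply: eq_eseriesr => t _; rewrite Zhat_sandwich.
have -> // : Zpart p ks S lam = Zp mu hardD lam (ind A).
by apply: eq_eseriesr => t _; rewrite Zhat_sandwich.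
Qed.

End Sandwich.

Let mhard := measurable_hard s mD.
Let hard0 := hard_ge0 D s.

Lemma density_ge0 (A : set T) lam : 0 <= lam -> 0 <= density mu hardD lam (ind A).
Proof.
move=> l0; have f0 x : (0 <= ind A x)%E by exact: ind_ge0.
rewrite /density !divr_ge0// fine_ge0//.
- by apply: nneseries_ge0 => t _ _; rewrite mule_ge0 ?lee_fin ?mulr_ge0 ?exprn_ge0// zc_ge0.
- by apply: nneseries_ge0 => t _ _; rewrite mule_ge0 ?lee_fin ?exprn_ge0// zc_ge0.
- exact: integral_ge0.
Qed.

Lemma density_mono (A : set T) (V l0 l : R) : measurable A -> mu A = V%:E ->
  0 < l0 <= l -> density mu hardD l0 (ind A) <= density mu hardD l (ind A).
Proof.
move=> mA AV l0l; have f0 x : (0 <= ind A x)%E by exact: ind_ge0.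
have mf := measurable_ind mA.
have fV : (\int[mu]_x ind A x = V%:E)%E by rewrite integral_ind.
rewrite /density ler_wpM2r//.
  by rewrite invr_ge0 fine_ge0// integral_ge0.
apply: (nneseries_mean_mono (a := fun t => zc mu hardD t (ind A))) => // [t|x x0|x x0|x x0].
- exact: zc_ge0.
- exact: Zp_ge1.
- exact: (Zp_fin mhard hard0 (soft_ge0 D s) (hard_soft D s) x0 mf f0 fV).
- exact: (mom_fin mhard hard0 (soft_ge0 D s) (hard_soft D s) x0 mf f0 fV).
Qed.

End Assembly.

Theorem theorem8 (R : realType) (p : R) (hp : 1 < p <= 2) :
  exists c : R, 0 < c < 2 /\
  exists eta : nat -> R, eta @ \oo --> 0 /\
  forall (n : nat) (ks : seq nat), (0 < n)%N -> valid_k n ks ->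
  forall S : set (n.-tuple R),
    leb_measurable S -> bounded_tset S -> (0 < vol S)%E ->
  forall lam : R, (n%:R)^-1 * (c ^+ n)^-1 <= lam ->
    (1 + eta n) * (ln (2 / c) * n%:R / 2 ^+ n) <= alpha p ks S lam.
Proof.
have /andP[k0 k1] := contraction_bounds hp.
set c := 2 * contraction p.
have c1 : 1 <= c by rewrite /c -ler_pdivrMl// mulr1.
have c0 : 0 < c := lt_le_trans ltr01 c1.
have c2 : c < 2 by rewrite /c -ltr_pdivlMl// mulVf.
exists c; split; first by rewrite c0.
set L := ln (2 / c); have L0 : 0 < L by rewrite ln_gt0// ltr_pdivlMr// mul1r.
exists (density_err L); split; first exact: density_err_cvg.
move=> n ks n0 vk S [A [B [mA mB AS SB BA0]]] [M SM] volS lam hlam.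
have [mu muE] := tuple_measure R n.
rewrite (vol_mu muE (measurableD mB mA)) in BA0.
rewrite (alpha_density p ks muE mA mB AS SB BA0).
have nR : 0 < n%:R :> R by rewrite ltr0n.
have cn : 0 < c ^+ n by rewrite exprn_gt0.
set l0 := n%:R^-1 * (c ^+ n)^-1 in hlam.
have l00 : 0 < l0 by rewrite mulr_gt0// invr_gt0.
have [n3|n3] := ltnP n 3.
  (* In dimensions 1 and 2 the error is -1, so the bound to prove is 0. *)
  rewrite /density_err n3 subrr mul0r; apply: density_ge0.
  exact: le_trans (ltW l00) hlam.
have volSA := vol_sandwich muE mA mB AS SB BA0.
have Afin : mu A \is a fin_num.
  rewrite ge0_fin_numE//; rewrite -volSA.
  have M0 : 0 <= `|M| by [].
  apply: (@le_lt_trans _ _ (vol (@cube R n `|M|))); last by rewrite vol_cube// ltry.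
  by apply: vol_homo => x Sx i; apply: le_trans (SM x Sx i) (ler_norm M).
have AV : mu A = (fine (mu A))%:E by rewrite fineK.
have V0 : 0 < fine (mu A) by rewrite -lte_fin -AV -volSA.
apply: le_trans (density_mono p ks mA AV (l := lam) (l0 := l0) _); last by rewrite l00.
apply: (@density_lower_bound _ _ c) => //; first exact: density_ge0 (ltW l00).
move=> W W1.
(* The sparsity constant is [2 c^n], so at the smallest fugacity allowed the local loss is
   [2 / n]. *)
have E : 2 / n%:R = l0 * (2 * c ^+ n) by rewrite /l0; field; rewrite !gt_eqF.
rewrite -/l0 E.
apply: (density_ind_ineq (@measurable_pkdist R p ks n) (@pkdistC R p ks n) l00
  _ (ltW cn) _ W1 mA V0 AV).
- by rewrite exprn_ge0.
- by rewrite -E ler_pdivrMr// mul1r ler_nat ltnW.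
- move=> x; rewrite -(vol_mu muE); last exact: measurable_soft_section (@measurable_pkdist R p ks n) x.
  apply: le_trans (vol_pkball_rn hp vk n0 x (ltr0n _ 2)).
  by apply: vol_homo => y /ltW.
- move=> x v xv; rewrite -(vol_mu muE); last exact: measurable_lens (@measurable_pkdist R p ks n) x v.
  exact: (vol_lens hp vk n0 (ltW xv)).
Qed.
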